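(* Let $\xi_0,\xi_1,\ldots$ be i.i.d. nondegenerate complex-valued random variables such that $\bar F(t):=\mathbb{P}[\log|\xi_0|>t]$ is slowly varying at $+\infty$ and $\xi_0\ne0$ a.s. Let $G_n(z)=\sum_{k=0}^n\xi_kz^k$. Let $\tau_n\in\{0,\ldots,n\}$ be an index with $|\xi_{\tau_n}|=\max_{k=0,\ldots,n}|\xi_k|$. Denote by $w_{1n},\ldots,w_{\tau_nn}$ the complex roots of the equation $\xi_{\tau_n}z^{\tau_n}+\xi_0=0$ and by $w_{(\tau_n+1)n},\ldots,w_{nn}$ the complex roots of the equation $\xi_nz^{n-\tau_n}+\xi_{\tau_n}=0$. Fix some $A>0$. Then the probability that the following three statements hold simultaneously goes to $1$ as $n\to\infty$: (1) $\tau_n$ is uniquely defined; (2) it is possible to number the roots $z_{1n},\ldots,z_{nn}$ of $G_n$ (counted with multiplicities) so that $$|z_{kn}-w_{kn}|<e^{-n^A}|w_{kn}|,\qquad 1\le k\le n;$$ (3) $|w_{kn}|<e^{-n^A}$ for $1\le k\le\tau_n$ and $|w_{kn}|>e^{n^A}$ for $\tau_n<k\le n$.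
   Context: If $\tau_n=0$ the first list of $w$'s is empty, and if $\tau_n=n$ the second list is empty. *)

(* Defs.v *)
From mathcomp Require Import all_boot all_order all_algebra finmap.
From mathcomp Require Import complex.
From mathcomp Require Import all_classical all_reals all_analysis.

Set Implicit Arguments.
Unset Strict Implicit.
Unset Printing Implicit Defensive.

Import Order.TTheory GRing.Theory Num.Theory.
Import numFieldNormedType.Exports.
Import ComplexField.Normc.

Local Open Scope classical_set_scope.
Local Open Scope ring_scope.

Section Random.
Context d (T : measurableType d) (R : realType) (P : probability T R).

Section Families.
Context d' (E : measurableType d').

Definition mutually_independent (X : nat -> T -> E) : Prop :=
  forall (J : {fset nat}) (B : nat -> set E), (forall k, measurable (B k)) ->
    P (\bigcap_(k in [set` J]) X k @^-1` B k) =
    (\prod_(k <- J) P (X k @^-1` B k))%E.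

Definition identically_distributed (X : nat -> T -> E) : Prop :=
  forall k (B : set E), measurable B -> P (X k @^-1` B) = P (X 0%N @^-1` B).

Definition iid (X : nat -> T -> E) : Prop :=
  [/\ forall k, measurable_fun setT (X k), mutually_independent X &
      identically_distributed X].

End Families.

(* The library has no Borel sigma-algebra on R[i]; C is identified with R^2,
   whose product sigma-algebra is the Borel one. *)
Definition reim (z : R[i]) : measurableTypeR R * measurableTypeR R :=
  (complex.Re z, complex.Im z).

Definition complex_iid (xi : nat -> T -> R[i]) : Prop :=
  iid (fun k w => reim (xi k w)).

Definition nondegenerate_rv (X : T -> R[i]) : Prop :=
  ~ exists c : R[i], {ae P, forall w, X w = c}.

(* [ln] is total with [ln 0 = 0], whereas log|0| would be -oo; the two readings
   agree as soon as X != 0 almost surely. *)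
Definition log_tail (X : T -> R[i]) (t : R) : R :=
  fine (P [set w | t < ln (normc (X w))]).

End Random.

Definition slowly_varying (R : realType) (f : R -> R) : Prop :=
  (\forall t \near +oo, 0 < f t) /\
  forall lam : R, 0 < lam -> f (lam * t) / f t @[t --> +oo] --> (1 : R).

Section Roots.
Context (R : realType).
Implicit Types (x : nat -> R[i]) (n tau : nat).

(* The roots of p with multiplicity, in some fixed order; empty for p = 0. *)
Definition roots_of (p : {poly R[i]}) : seq R[i] :=
  if p == 0 then [::] else sval (closed_field_poly_normal p).

Definition Gpoly x n : {poly R[i]} := \sum_(k < n.+1) x k *: 'X^k.

Definition is_max_index x n tau : Prop :=
  (tau <= n)%N /\ forall k, (k <= n)%N -> normc (x k) <= normc (x tau).

(* When tau = 0 (resp. tau = n) the first (resp. second) polynomial is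
   constant, hence contributes no root. *)
Definition wseq x n tau : seq R[i] :=
  roots_of (x tau *: 'X^tau + (x 0%N)%:P) ++
  roots_of (x n *: 'X^(n - tau) + (x tau)%:P).

(* 0-based: [wroot x n tau k] is w_{(k+1)n}. *)
Definition wroot x n tau (k : nat) : R[i] := nth 0 (wseq x n tau) k.

Definition unique_max x n tau : Prop :=
  forall k, is_max_index x n k -> k = tau.

Definition roots_close (A : R) x n tau : Prop :=
  exists2 z : n.-tuple R[i], perm_eq z (roots_of (Gpoly x n)) &
    forall k : 'I_n, normc (tnth z k - wroot x n tau k)
                     < expR (- (n%:R `^ A)) * normc (wroot x n tau k).

Definition roots_separated (A : R) x n tau : Prop :=
  forall k : 'I_n,
    if (k < tau)%N then normc (wroot x n tau k) < expR (- (n%:R `^ A))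
    else expR (n%:R `^ A) < normc (wroot x n tau k).

End Roots.

(* Main.v *)
Require Import Defs.
From mathcomp Require Import all_boot all_order all_algebra all_field finmap.
From mathcomp Require Import complex.
From mathcomp Require Import all_classical all_reals all_analysis.
From mathcomp Require Import perm measurable_realfun.
From mathcomp Require Import ring lra zify.

Set Implicit Arguments.
Unset Strict Implicit.
Unset Printing Implicit Defensive.

Import Order.TTheory GRing.Theory Num.Theory.
Import numFieldNormedType.Exports.
Import ComplexField.Normc.

Local Open Scope classical_set_scope.
Local Open Scope ring_scope.

(** Put a_k = log |xi_k|. With high probability the coefficient of largest
    modulus, of index t, is so dominant that the broken line joining (0, a_0),
    (t, a_t) and (n, a_n) lies above all other points (k, a_k) with a margin
    larger than n^A. This is the situation of a Newton polygon with two edges: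
    for |z| = (|xi_0| / |xi_t|)^(1/t) only the terms of index 0 and t matter,
    for |z| = (|xi_t| / |xi_n|)^(1/(n-t)) only those of index t and n, and the
    roots of G_n are close to the roots of the two binomials.

    Deterministic part. At a root w of one of the binomials the two main terms
    of G_n cancel, so G_n(w) consists of negligible terms, whereas in w G_n'(w)
    the two main terms have different integer weights and do not cancel. Since
    G_n'/G_n = sum of 1/(z - z_i), some root of G_n lies within n |G_n(w)| /
    |G_n'(w)| of w ([exists_root_near]). The n roots w are separated by at
    least |w|/n ([pow_eq_separated]), so these n roots of G_n are distinct and
    are all of them ([match_roots]). This gives [dominant_coefficient_roots],
    in which the tent condition reads
    2n a_k <= min(k, n - k) a_t for 0 < k < n, k <> t, with a_0 and a_n bounded
    and a_t at least a large multiple of n^(N+1), N >= A.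

    Probabilistic part. Let F be the tail of log |xi_0|, fix c large and let s
    satisfy c <= n F(s) <= 2c ([exists_quantile]). The maximum a_t exceeds s
    with probability close to 1 ([pr_none_exceeds]), and s grows faster than
    every power of n ([quantile_growth]). The tent condition with a_t > s fails
    only if for some i <> j one has s < a_i and
    min(j, n - j)/(2n) a_i < a_j <= a_i. Conditionally on a_i = r this has
    probability F(min(j, n - j) r / 2n) - F(r), and the sum over j of these
    numbers is o(n F(r)): this is Karamata's theorem for the slowly varying
    function F ([karamata_sum]). Summing over i and integrating over r > s
    bounds the probability of failure by o((n F(s))^2) = o(c^2). The
    integration is done over the dyadic levels 2^m s
    ([pr_dyadic_competitor], [sum_pr_dyadic_competitor]).

    Measurability. The roots need not be measurable in any fixed enumeration,
    but for nonzero xi_t and xi_n the existence of a suitable numbering is an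
    open condition on (xi_0, ..., xi_n), because the roots of a polynomial depend
    continuously on its coefficients ([roots_continuous], [roots_close_open]);
    an open set is a countable union of rational boxes
    ([measurable_open_coordinates]). *)

(** * Polynomials over the complex numbers and their roots *)

Section NormcTheory.
Context (R : realType).
Implicit Types (x y z : R[i]).

Lemma normc_ge0 z : 0 <= normc z.
Proof. by case: z => a b; exact: sqrtr_ge0. Qed.

Lemma normc_eq0 z : (normc z == 0) = (z == 0).
Proof. by apply/eqP/eqP => [/eq0_normc|->]; rewrite ?normc0. Qed.

Lemma normc_gt0 z : (0 < normc z) = (z != 0).
Proof. by rewrite lt_def normc_ge0 andbT normc_eq0. Qed.

Lemma normcD x y : normc (x + y) <= normc x + normc y.
Proof. exact: le_normcD. Qed.

Lemma normcB x y : normc (x - y) <= normc x + normc y.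
Proof. by rewrite -(normcN y); exact: normcD. Qed.

Lemma normcBC x y : normc (x - y) = normc (y - x).
Proof. by rewrite -(normcN (x - y)) opprB. Qed.

Lemma lerB_normc x y : normc x - normc y <= normc (x - y).
Proof. by rewrite lerBlDr -{1}(subrK y x); exact: normcD. Qed.

Lemma lerD_normc x y : normc x - normc y <= normc (x + y).
Proof. by rewrite -{1}(normcN y) -{2}(opprK y) lerB_normc. Qed.

Lemma normcX z k : normc (z ^+ k) = normc z ^+ k.
Proof. by elim: k => [|k IH]; rewrite ?normc1// !exprS normcM IH. Qed.

Lemma normc_nat k : normc (k%:R : R[i]) = k%:R.
Proof. by rewrite normcMn normc1. Qed.

Lemma normc_sum (I : Type) (r : seq I) (Q : pred I) (F : I -> R[i]) :
  normc (\sum_(i <- r | Q i) F i) <= \sum_(i <- r | Q i) normc (F i).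
Proof.
elim/big_rec2: _ => [|i u v _ h]; first by rewrite normc0.
by rewrite (le_trans (normcD _ _))// lerD2l.
Qed.

End NormcTheory.

Section RootsOf.
Context (R : realType).
Implicit Types (p : {poly R[i]}) (s : seq R[i]).

Lemma roots_ofE p : p = lead_coef p *: \prod_(z <- roots_of p) ('X - z%:P).
Proof.
rewrite /roots_of; case: eqVneq => [->|_]; first by rewrite lead_coef0 scale0r.
exact: (svalP (closed_field_poly_normal p)).
Qed.

Lemma size_roots_of p : p != 0 -> size (roots_of p) = (size p).-1.
Proof.
move=> p0; rewrite [in RHS](roots_ofE p) size_scale ?lead_coef_eq0//.
by rewrite size_prod_XsubC.
Qed.

Lemma mem_roots_of p z : p != 0 -> (z \in roots_of p) = root p z.
Proof.
move=> p0; rewrite [in RHS](roots_ofE p) rootZ ?lead_coef_eq0//.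
by rewrite root_prod_XsubC.
Qed.

Lemma roots_of_const (c : R[i]) : roots_of c%:P = [::].
Proof.
have [->|c0] := eqVneq c 0; first by rewrite /roots_of polyC0 eqxx.
by apply/nilP; rewrite /nilp size_roots_of ?polyC_eq0// size_polyC c0.
Qed.

Lemma perm_roots_of (c : R[i]) s : c != 0 ->
  perm_eq (roots_of (c *: \prod_(z <- s) ('X - z%:P))) s.
Proof.
move=> c0; set p := _ *: _; apply: prod_XsubC_eq.
have lc : lead_coef p = c by rewrite lead_coefZ lead_coef_prod_XsubC mulr1.
apply: (scalerI c0); rewrite -/p -lc; symmetry; exact: roots_ofE.
Qed.

Lemma perm_roots_ofM p q : p != 0 -> q != 0 ->
  perm_eq (roots_of (p * q)) (roots_of p ++ roots_of q).
Proof.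
move=> p0 q0; rewrite {1}(roots_ofE p) {1}(roots_ofE q) -scalerAl -scalerAr.
by rewrite scalerA -big_cat perm_roots_of// mulf_neq0 ?lead_coef_eq0.
Qed.

End RootsOf.

Section NearestRoot.
Context (R : realType).
Implicit Types (p : {poly R[i]}) (s : seq R[i]) (w z : R[i]).

(** This is |q'/q| <= sum of 1/|w - z_i|, with denominators cleared so that
    it also makes sense at a root of q. *)
Lemma deriv_prod_XsubC_le s w (r : R) :
  (forall z, z \in s -> r <= normc (w - z)) ->
  normc ((\prod_(z <- s) ('X - z%:P))^`().[w]) * r
    <= (size s)%:R * normc (\prod_(z <- s) ('X - z%:P)).[w].
Proof.
elim: s => [_|a s IH h].
  by rewrite !big_nil derivC horner0 normc0 !mul0r.
rewrite !big_cons; set q := \prod_(z <- s) _ in IH *.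
have {}IH : normc q^`().[w] * r <= (size s)%:R * normc q.[w].
  by apply: IH => z zs; apply: h; rewrite in_cons zs orbT.
have ra : r <= normc (w - a) by apply: h; rewrite mem_head.
rewrite derivM derivXsubC mul1r hornerD !hornerM hornerXsubC normcM /=.
set u := q.[w] in IH *; set v := q^`().[w] in IH *.
have [r0|r0] := leP 0 r; last first.
  apply: (@le_trans _ _ 0); first by rewrite mulr_ge0_le0 ?normc_ge0 ?ltW.
  by rewrite !mulr_ge0 ?normc_ge0.
apply: (@le_trans _ _ ((normc u + normc (w - a) * normc v) * r)).
  by rewrite ler_wpM2r// -normcM normcD.
have u0 := normc_ge0 u; have v0 := normc_ge0 v.
have a0 := normc_ge0 (w - a).
rewrite -natr1; nra.
Qed.

(** A lower bound on the logarithmic derivative forces a root nearby; it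
    replaces Rouche's theorem throughout. *)
Lemma exists_root_near p w (r : R) : p != 0 ->
  (size p).-1%:R * normc p.[w] < r * normc p^`().[w] ->
  exists2 z, z \in roots_of p & normc (z - w) < r.
Proof.
move=> p0 hw; have [//|no] := pselect (exists2 z, z \in roots_of p & normc (z - w) < r).
have far z : z \in roots_of p -> r <= normc (w - z).
  by move=> zr; rewrite leNgt normcBC; apply/negP => zw; apply: no; exists z.
have := deriv_prod_XsubC_le far.
rewrite size_roots_of// => le.
move: hw; rewrite {2 3}(roots_ofE p) derivZ !hornerZ !normcM.
rewrite mulrCA (mulrCA r) ltr_pM2l ?normc_gt0 ?lead_coef_eq0// => hw.
by move: le; rewrite mulrC leNgt hw.
Qed.

End NearestRoot.

Section GpolyTheory.
Context (R : realType).
Implicit Types (x : nat -> R[i]) (w : R[i]).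

Lemma coef_Gpoly x n k : (Gpoly x n)`_k = if (k <= n)%N then x k else 0.
Proof.
rewrite /Gpoly coef_sum; case: leqP => kn.
  rewrite (bigD1 (Ordinal (kn : (k < n.+1)%N)))//= coefZ coefXn eqxx mulr1.
  rewrite big1 ?addr0// => i; rewrite -val_eqE/= => ik.
  by rewrite coefZ coefXn eq_sym (negbTE ik) mulr0.
rewrite big1// => i _; rewrite coefZ coefXn gtn_eqF ?mulr0//.
exact: leq_ltn_trans (leq_ord i) kn.
Qed.

Lemma size_Gpoly_le x n : (size (Gpoly x n) <= n.+1)%N.
Proof. by apply/leq_sizeP => j nj; rewrite coef_Gpoly leqNgt nj. Qed.

Lemma size_Gpoly x n : x n != 0 -> size (Gpoly x n) = n.+1.
Proof.
move=> xn; apply/eqP; rewrite eqn_leq size_Gpoly_le ltnNge.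
by apply: contra xn => /leq_sizeP/(_ n (leqnn n)); rewrite coef_Gpoly leqnn => ->.
Qed.

Lemma Gpoly_neq0 x n : x n != 0 -> Gpoly x n != 0.
Proof. by move=> xn; rewrite -size_poly_eq0 size_Gpoly. Qed.

Lemma horner_Gpoly x n w : (Gpoly x n).[w] = \sum_(k < n.+1) x k * w ^+ k.
Proof.
by rewrite horner_sum; apply: eq_bigr => k _; rewrite hornerZ hornerXn.
Qed.

Lemma horner_deriv_Gpoly x n w :
  w * (Gpoly x n)^`().[w] = \sum_(k < n.+1) k%:R * (x k * w ^+ k).
Proof.
rewrite raddf_sum horner_sum mulr_sumr; apply: eq_bigr => -[[|k] kn] _ /=.
  by rewrite derivZ derivXn/= mulr0n scaler0 horner0 mulr0 mul0r.
rewrite derivZ derivXn/= hornerZ hornerMn hornerXn exprS -mulr_natl.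
by ring.
Qed.

(** At w the terms of index a and b cancel in G, but in w G' they carry the
    weights a and b, and (b - a) |x_a w^a| survives. The factor 4 n^2 beats the
    number of remaining terms, their weights j <= n, and the degree in
    [exists_root_near]. *)
Lemma Gpoly_root_near x n (a b : nat) w (dlt : R) :
  (a < b <= n)%N -> x n != 0 -> x a != 0 -> w != 0 ->
  x b * w ^+ b = - (x a * w ^+ a) ->
  0 < dlt <= 1 ->
  (forall j, (j <= n)%N -> j != a -> j != b ->
     n%:R ^+ 2 * 4 * normc (x j * w ^+ j) <= dlt * normc (x a * w ^+ a)) ->
  exists2 z, z \in roots_of (Gpoly x n) & normc (z - w) < dlt * normc w.
Proof.
move=> /andP[ab bn] xn0 xa0 w0 hba /andP[dlt0 dlt1] small.
have n0 : (0 < n)%N by apply: leq_trans bn; apply: leq_ltn_trans ab.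
have an : (a < n.+1)%N by rewrite ltnS (leq_trans (ltnW ab)).
pose oa : 'I_n.+1 := Ordinal an; pose ob : 'I_n.+1 := Ordinal (bn : (b < n.+1)%N).
have oba : ob != oa by rewrite -val_eqE/= gtn_eqF.
set B := normc (x a * w ^+ a) in small *.
have B0 : 0 < B by rewrite normc_gt0 mulf_neq0 ?expf_neq0.
pose S := \sum_(k < n.+1 | (k != oa) && (k != ob)) normc (x k * w ^+ k).
have S_le : n%:R * 4 * S <= dlt * B.
  have nR : (0 : R) < n%:R by rewrite ltr0n.
  rewrite -(ler_pM2l nR) mulr_sumr mulr_sumr.
  apply: (@le_trans _ _ (\sum_(k < n.+1 | (k != oa) && (k != ob)) (dlt * B))).
    apply: ler_sum => k /andP[ka kb]; apply: le_trans (small k _ ka kb).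
      by rewrite le_eqVlt; apply/orP; left; apply/eqP; ring.
    exact: leq_ord.
  rewrite sumr_const -(mulr_natl (dlt * B)) ler_wpM2r ?mulr_ge0 ?(ltW B0) ?(ltW dlt0)//.
  rewrite ler_nat.
  have cD : #|predC1 oa| = n by rewrite cardC1 card_ord.
  apply: (@leq_trans #|predC1 oa|); last by rewrite cD.
  by apply: subset_leq_card; apply/fintype.subsetP => k; rewrite !inE => /andP[->].
have S0 : 0 <= S by apply: sumr_ge0 => k _; exact: normc_ge0.
have split2 (F : nat -> R[i]) : \sum_(k < n.+1) F k =
    F a + F b + \sum_(k < n.+1 | (k != oa) && (k != ob)) F k.
  by rewrite (bigD1 oa)//= (bigD1 ob)//= addrA.
have Gle : normc (Gpoly x n).[w] <= S.
  rewrite horner_Gpoly (split2 (fun k => x k * w ^+ k)) hba subrr add0r.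
  exact: normc_sum.
have dGge : B - n%:R * S <= normc (w * (Gpoly x n)^`().[w]).
  rewrite horner_deriv_Gpoly (split2 (fun k => k%:R * (x k * w ^+ k))) hba.
  apply: le_trans (lerD_normc _ _); apply: lerB.
    rewrite mulrN -mulrBl normcM normcBC -/B -natrB ?(ltnW ab)// normc_nat.
    by rewrite -{1}(mul1r B) ler_pM2r// ler1n subn_gt0.
  apply: (le_trans (normc_sum _ _ _)); rewrite mulr_sumr; apply: ler_sum => k _.
  by rewrite normcM normc_nat ler_wpM2r ?normc_ge0// ler_nat leq_ord.
have [||z zr zw] := @exists_root_near _ (Gpoly x n) w (dlt * normc w).
- exact: Gpoly_neq0.
- rewrite size_Gpoly//= -mulrA -normcM.
  have nR : (1 : R) <= n%:R by rewrite ler1n.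
  set u := normc (Gpoly x n).[w] in Gle *; set v := normc _ in dGge *.
  have u0 : 0 <= u by exact: normc_ge0.
  apply: (@le_lt_trans _ _ (n%:R * S)); first by rewrite ler_wpM2l// (le_trans _ nR).
  apply: (@lt_le_trans _ _ (dlt * (B - n%:R * S))); last by rewrite ler_pM2l.
  set N := n%:R * S in S_le *.
  have NE : N * 4 <= dlt * B by rewrite /N mulrAC.
  have N0 : 0 <= N by rewrite mulr_ge0// (le_trans _ nR).
  nra.
by exists z.
Qed.

(** Distinct m-th roots u, v of the same number are at distance at least
    |u|/m. With om = v/u the powers of om sum to 0, so the m numbers om^i - 1
    sum to -m, while the modulus of each is at most i |om - 1|. *)
Lemma pow_eq_separated m (c u v : R[i]) : (0 < m)%N ->
  u ^+ m = c -> v ^+ m = c -> u != v -> normc u <= m%:R * normc (u - v).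
Proof.
move=> m0 uc vc uv.
have [u0|u0] := eqVneq u 0; first by rewrite u0 normc0 mulr_ge0 ?normc_ge0.
pose om := v / u.
have om1 : om ^+ m = 1 by rewrite expr_div_n uc vc divff// -uc expf_neq0.
have omn1 : om != 1 by apply: contra uv => /eqP h; rewrite -(divfK u0 v) -/om h mul1r.
have nom : normc om = 1.
  apply/eqP; have := congr1 (@normc R) om1; rewrite normcX normc1 => /eqP.
  by rewrite pexpr_eq1 ?normc_ge0.
have sum0 : \sum_(i < m) om ^+ i = 0.
  have := subrX1 om m; rewrite om1 subrr => /esym/eqP.
  by rewrite mulf_eq0 subr_eq0 (negbTE omn1)/= => /eqP.
have pow_le i : normc (om ^+ i - 1) <= i%:R * normc (om - 1).
  elim: i => [|i IH]; first by rewrite expr0 subrr normc0 mul0r.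
  have -> : om ^+ i.+1 - 1 = om * (om ^+ i - 1) + (om - 1) by rewrite exprS; ring.
  by rewrite (le_trans (normcD _ _))// normcM nom mul1r -natr1 mulrDl mul1r lerD2r.
have : m%:R <= \sum_(i < m) (m%:R * normc (om - 1)).
  have mE : (m%:R : R) = normc (\sum_(i < m) (om ^+ i - 1)).
    by rewrite sumrB sum0 sub0r normcN sumr_const card_ord normc_nat.
  rewrite {1}mE; apply: le_trans (normc_sum _ _ _) _; apply: ler_sum => i _.
  apply: le_trans (pow_le i) _; apply: ler_wpM2r; first exact: normc_ge0.
  by rewrite ler_nat ltnW.
rewrite sumr_const card_ord -(mulr_natl (m%:R * _)) -{1}(mulr1 m%:R) ler_pM2l ?ltr0n// => h.
have -> : u - v = - u * (om - 1) by rewrite /om; field.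
rewrite normcM normcN mulrCA -{1}(mulr1 (normc u)) ler_wpM2l ?normc_ge0//.
Qed.

Section Binomial.
Context (a b : R[i]) (m : nat).
Hypothesis a0 : a != 0.
Let p : {poly R[i]} := a *: 'X^m + b%:P.

Lemma size_binomial : (0 < m)%N -> size p = m.+1.
Proof.
move=> m0; rewrite /p size_polyDl size_scale// ?size_polyXn//.
by rewrite size_polyC; case: (b != 0).
Qed.

Lemma binomial_neq0 : (0 < m)%N -> p != 0.
Proof. by move=> m0; rewrite -size_poly_eq0 size_binomial. Qed.

Lemma size_roots_binomial : size (roots_of p) = m.
Proof.
case: (posnP m) => [m0|m0]; last by rewrite size_roots_of ?binomial_neq0 ?size_binomial.
by rewrite /p m0 expr0 -(polyC1 R[i]) -mul_polyC -polyCM -polyCD roots_of_const.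
Qed.

Lemma mem_roots_binomial w : w \in roots_of p -> a * w ^+ m = - b.
Proof.
case: (posnP m) => [m0|m0].
  by rewrite /p m0 expr0 -(polyC1 R[i]) -mul_polyC -polyCM -polyCD roots_of_const.
rewrite mem_roots_of ?binomial_neq0// /root /p hornerD hornerZ hornerXn hornerC.
by rewrite addr_eq0 => /eqP.
Qed.

Lemma normc_roots_binomial w : w \in roots_of p ->
  normc a * normc w ^+ m = normc b.
Proof. by move=> /mem_roots_binomial h; rewrite -normcX -normcM h normcN. Qed.

Lemma uniq_roots_binomial : b != 0 -> uniq (roots_of p).
Proof.
move=> b0; case: (posnP m) => [m0|m0].
  by rewrite /p m0 expr0 -(polyC1 R[i]) -mul_polyC -polyCM -polyCD roots_of_const.
rewrite -separable_prod_XsubC.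
have p0 := binomial_neq0 m0.
rewrite -(@eqp_separable _ (lead_coef p *: \prod_(x <- roots_of p) ('X - x%:P))).
  rewrite -roots_ofE unlock; apply/Bezout_coprimepP.
  exists (m%:R%:P, - 'X) => /=.
  have -> : m%:R%:P * p + - 'X * p^`() = (m%:R * b)%:P.
    rewrite /p derivD derivZ derivXn derivC addr0 polyCM.
    have -> : 'X^m = 'X * 'X^(m.-1) :> {poly R[i]} by rewrite -exprS prednK.
    rewrite -(scaler_nat m 'X^(m.-1)) -!mul_polyC.
    ring.
  rewrite polyC_eqp1 mulf_neq0// pnatr_eq0 -lt0n//.
by rewrite eqp_scale// lead_coef_eq0.
Qed.

End Binomial.

(** Disjoint discs around the w's each contain a root, so that a choice of
    one root per disc is injective and, by counting, exhausts all roots. *)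
Lemma match_roots n (zs ws : seq R[i]) (dlt : R) :
  size ws = n -> size zs = n -> uniq ws ->
  (forall w, w \in ws -> exists2 z, z \in zs & normc (z - w) < dlt * normc w) ->
  {in ws &, forall u v, u != v -> dlt * normc u + dlt * normc v <= normc (u - v)} ->
  exists2 z : n.-tuple R[i], perm_eq z zs &
    forall k : 'I_n, normc (tnth z k - nth 0 ws k) < dlt * normc (nth 0 ws k).
Proof.
move=> sws szs uws near sep.
pose f w := if pselect (exists2 z, z \in zs & normc (z - w) < dlt * normc w) is left h
  then s2val (cid2 h) else 0.
have fP w : w \in ws -> f w \in zs /\ normc (f w - w) < dlt * normc w.
  move=> /near h; rewrite /f; case: pselect => // h'.
  by case: (cid2 h') => z /= ? ?; split.
have inj : {in ws &, injective f}.
  move=> u v uw vw fuv; apply/eqP; apply: contraT => uv.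
  have [_ fu] := fP _ uw; have [_ fv] := fP _ vw.
  have := sep _ _ uw vw uv; rewrite leNgt => /negP; case.
  have -> : u - v = (u - f u) + (f v - v) by rewrite fuv; ring.
  by rewrite (le_lt_trans (normcD _ _))// ltrD// normcBC.
have sz : size [seq f w | w <- ws] == n by rewrite size_map sws.
exists (Tuple sz) => /=.
  have ufs : uniq [seq f w | w <- ws] by rewrite map_inj_in_uniq.
  have sub : {subset [seq f w | w <- ws] <= zs}.
    by move=> _ /mapP[w ww ->]; case: (fP _ ww).
  have le : (size zs <= size [seq f w | w <- ws])%N by rewrite szs (eqP sz).
  have [_ e] := uniq_min_size ufs sub le.
  exact: uniq_perm ufs (leq_size_uniq ufs sub le) e.
move=> k; rewrite (tnth_nth 0) /= (nth_map 0) ?sws//.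
by case: (fP (nth 0 ws k)) => //; rewrite mem_nth ?sws.
Qed.

End GpolyTheory.

(** * Roots when one coefficient dominates *)

Section DominantCoefficient.
Context (R : realType).

(** On an edge of the tent of horizontal length T, the gain J s / (2 N) from
    the slope at distance J from the low end dominates all bounded errors. The
    low end has height a, the top height s, and rho is minus the slope. It serves
    both edges, the second one after reflection. *)
Lemma tent_slope (s K D N T J a aj rho : R) :
  0 <= D -> 0 <= K -> 1 <= J -> J <= T -> T <= N ->
  - K <= a -> T * rho = a - s -> 2 * N * (2 * K + 2 * D) <= s ->
  aj * (2 * N) <= J * s -> aj + J * rho <= a - 2 * D.
Proof.
move=> D0 K0 J1 JT TN aK hrho hs haj.
have T0 : 0 < T by lra.
have N0 : 0 < N by lra.
rewrite -(ler_pM2l T0).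
have -> : T * (aj + J * rho) = T * aj + J * (a - s) by rewrite -hrho; ring.
have s0 : 0 <= s by apply: le_trans hs; apply: mulr_ge0; lra.
have h1 : T * aj <= J * s / 2.
  have [aj0|aj0] := leP 0 aj; last first.
    apply: (@le_trans _ _ 0); first by rewrite mulr_ge0_le0 ?ltW.
    by rewrite divr_ge0 ?mulr_ge0 ?(le_trans _ J1).
  have : T * aj <= N * aj by rewrite ler_wpM2r.
  lra.
have h2 : N * (2 * K + 2 * D) <= J * s / 2.
  have : s <= J * s by rewrite ler_peMl.
  lra.
have h3 : T * (2 * K + 2 * D) <= N * (2 * K + 2 * D).
  by apply: ler_wpM2r => //; lra.
have h4 : 0 <= (T - J) * (a + K) by apply: mulr_ge0; lra.
nra.
Qed.

(** The roots of the first binomial have log-modulus (a_0 - a_t)/t <= -2D and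
    those of the second one (a_t - a_n)/(n - t) >= 2D. The margin is 2D rather
    than D because one factor exp(-D) pays for the polynomial factors in n. *)
Lemma dominant_coefficient_roots (x : nat -> R[i]) (n t : nat) (K D A : R) :
  let a j := ln (normc (x j)) in
  (0 < t < n)%N -> x 0%N != 0 -> x n != 0 -> 0 <= K -> 0 < D ->
  4 * n%:R ^+ 2 <= expR D -> n%:R `^ A <= D ->
  - K <= a 0%N <= K -> - K <= a n <= K ->
  2 * n%:R * (2 * K + 2 * D) <= a t ->
  (forall j, (0 < j < n)%N -> j != t -> x j != 0 ->
     a j * (2 * n%:R) <= (minn j (n - j))%:R * a t) ->
  [/\ unique_max x n t, roots_close A x n t & roots_separated A x n t].
Proof.
move=> a /andP[t0 tn] x0 xn K0 D0 nD nAD /andP[a0K a0K'] /andP[anK anK'] hs hj.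
set s := a t in hs hj.
have n0 : (0 < n)%N by exact: ltn_trans tn.
have n1 : (1 : R) <= n%:R by rewrite ler1n.
have sK : K + 2 * D * n%:R < s by apply: lt_le_trans hs; nra.
have s0 : 0 < s by nra.
have xt : x t != 0.
  by apply: contraTneq s0 => xt0; rewrite /s /a xt0 normc0 ln0// ltxx.
have xjs j : (j <= n)%N -> j != t -> x j != 0 -> a j < s.
  move=> jn jt xj; have [j00|j0] := posnP j; first by rewrite j00; nra.
  have [jnn|jln] := eqVneq j n; first by rewrite jnn; nra.
  have := hj j; rewrite j0 ltn_neqAle jln jn => /(_ isT jt xj) h.
  have hm : ((minn j (n - j))%:R : R) <= n%:R by rewrite ler_nat geq_min jn.
  have : (minn j (n - j))%:R * s <= n%:R * s by rewrite ler_wpM2r// ltW.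
  nra.
have normE j w : x j != 0 -> w != 0 ->
    normc (x j * w ^+ j) = expR (a j + j%:R * ln (normc w)).
  move=> xj w0; rewrite expRD expRM_natl !lnK ?posrE ?normc_gt0//.
  by rewrite normcM normcX.
pose w1 := roots_of (x t *: 'X^t + (x 0%N)%:P).
pose w2 := roots_of (x n *: 'X^(n - t) + (x t)%:P).
have sw1 : size w1 = t by exact: size_roots_binomial.
have sw2 : size w2 = (n - t)%N by exact: size_roots_binomial.
have nt0 : (0 < n - t)%N by rewrite subn_gt0.
have w1n0 w : w \in w1 -> w != 0.
  move=> /(mem_roots_binomial xt); apply: contra_eqN => /eqP ->.
  by rewrite expr0n gtn_eqF// mulr0 eq_sym oppr_eq0.
have w2n0 w : w \in w2 -> w != 0.
  move=> /(mem_roots_binomial xn); apply: contra_eqN => /eqP ->.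
  by rewrite expr0n gtn_eqF// mulr0 eq_sym oppr_eq0.
have lnE (b c : R[i]) m w : b != 0 -> c != 0 -> w != 0 -> normc b * normc w ^+ m = normc c ->
    ln (normc b) + m%:R * ln (normc w) = ln (normc c).
  move=> b0 c0 w0 <-; rewrite lnM ?posrE ?exprn_gt0 ?normc_gt0// lnXn ?normc_gt0//.
  by rewrite mulr_natl.
have rho1 w : w \in w1 -> t%:R * ln (normc w) = a 0%N - s.
  move=> ww; have h := lnE _ _ _ w xt x0 (w1n0 _ ww) (normc_roots_binomial xt ww).
  by rewrite /s /a -h; ring.
have rho2 w : w \in w2 -> (n - t)%:R * - ln (normc w) = a n - s.
  move=> ww; have h := lnE _ _ _ w xn xt (w2n0 _ ww) (normc_roots_binomial xn ww).
  by rewrite /s /a -h; ring.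
have rho_le m (c r : R) : (0 < m <= n)%N -> c <= K -> m%:R * r = c - s -> r <= - (2 * D).
  move=> /andP[m0 mn] cK h; have m0R : (0 : R) < m%:R by rewrite ltr0n.
  have mnR : (m%:R : R) <= n%:R by rewrite ler_nat.
  rewrite -(ler_pM2l m0R) h; nra.
have lnw1 w : w \in w1 -> ln (normc w) <= - (2 * D).
  by move=> /rho1; apply: rho_le => //; rewrite t0 ltnW.
have lnw2 w : w \in w2 -> 2 * D <= ln (normc w).
  move=> /rho2 h; rewrite -lerN2; apply: rho_le h => //.
  by rewrite nt0 leq_subr.
have norm_w1 w : w \in w1 -> normc w <= expR (- (2 * D)).
  by move=> ww; rewrite -(lnK (x := normc w)) ?posrE ?normc_gt0 ?w1n0// ler_expR lnw1.
have norm_w2 w : w \in w2 -> expR (2 * D) <= normc w.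
  by move=> ww; rewrite -(lnK (x := normc w)) ?posrE ?normc_gt0 ?w2n0// ler_expR lnw2.
set dlt := expR (- D).
have dlt0 : 0 < dlt by exact: expR_gt0.
have dlt0' := ltW dlt0; have s0' := ltW s0.
have ndlt : 4 * n%:R ^+ 2 * dlt <= 1.
  by rewrite /dlt expRN ler_pdivrMr ?expR_gt0// mul1r.
have ndlt' : 4 * n%:R * dlt <= 1.
  apply: le_trans ndlt; rewrite ler_wpM2r// ler_wpM2l// expr2.
  by rewrite ler_peMl// (le_trans _ n1).
have dlt1 : 4 * dlt <= 1 by apply: le_trans ndlt'; rewrite ler_wpM2r//; lra.
have exp2D : expR (- (2 * D)) = dlt * dlt by rewrite -expRD; congr expR; ring.
have term j b w (c : R) : x j != 0 -> x b != 0 -> w != 0 ->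
    a j + j%:R * ln (normc w) <= a b + b%:R * ln (normc w) - 2 * D ->
    n%:R ^+ 2 * 4 * normc (x j * w ^+ j) <= dlt * normc (x b * w ^+ b).
  move=> xj xb w0 h; rewrite !normE//.
  set u := expR (_ + _); set v := expR (_ + _).
  have uv : u <= v * (dlt * dlt) by rewrite -exp2D -expRD ler_expR.
  have v0 : 0 < v by exact: expR_gt0.
  apply: (@le_trans _ _ (n%:R ^+ 2 * 4 * (v * (dlt * dlt)))).
    by rewrite ler_wpM2l// mulr_ge0// sqr_ge0.
  have -> : n%:R ^+ 2 * 4 * (v * (dlt * dlt)) = 4 * n%:R ^+ 2 * dlt * (dlt * v) by ring.
  by rewrite ler_piMl// mulr_ge0// ltW.
have near1 w : w \in w1 ->
    exists2 z, z \in roots_of (Gpoly x n) & normc (z - w) < dlt * normc w.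
  move=> ww; have w0 := w1n0 _ ww.
  apply: (@Gpoly_root_near _ x n 0 t) => //.
  - by rewrite t0 ltnW.
  - by rewrite expr0 mulr1; apply: mem_roots_binomial xt _ ww.
  - by rewrite dlt0/=; lra.
  move=> j jn j0 jt; have [->|xj] := eqVneq (x j) 0.
    by rewrite mul0r normc0 mulr0 mulr_ge0 ?normc_ge0.
  apply: term => //; rewrite mul0r addr0.
  have tnR : (t%:R : R) <= n%:R by rewrite ler_nat ltnW.
  have [jlt|] := ltnP j t.
    apply: (@tent_slope s K D n%:R t%:R) => //.
    - exact: ltW.
    - by rewrite ler1n lt0n.
    - by rewrite ler_nat ltnW.
    - exact: rho1.
    - apply: le_trans (hj j _ jt xj) _; first by rewrite lt0n j0 (ltn_trans jlt).
      by rewrite ler_wpM2r// ler_nat geq_minl.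
  rewrite leq_eqVlt eq_sym (negbTE jt)/= => tj.
  have := rho1 _ ww; have := lnw1 _ ww; set rho := ln _ => hr hr1.
  have : t%:R + 1 <= (j%:R : R) by rewrite natr1 ler_nat.
  have := xjs j jn jt xj; nra.
have near2 w : w \in w2 ->
    exists2 z, z \in roots_of (Gpoly x n) & normc (z - w) < dlt * normc w.
  move=> ww; have w0 := w2n0 _ ww.
  apply: (@Gpoly_root_near _ x n t n) => //.
  - by rewrite tn leqnn.
  - have -> : w ^+ n = w ^+ (n - t) * w ^+ t by rewrite -exprD subnK// ltnW.
    rewrite mulrA.
    by rewrite (mem_roots_binomial xn ww) mulNr.
  - by rewrite dlt0/=; lra.
  move=> j jn jt jnn; have [->|xj] := eqVneq (x j) 0.
    by rewrite mul0r normc0 mulr0 mulr_ge0 ?normc_ge0.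
  have jln : (j < n)%N by rewrite ltn_neqAle jnn.
  apply: term => //.
  have := rho2 _ ww; have := lnw2 _ ww; set rho := ln _ => hr hr1.
  have [tj|] := ltnP t j.
    have jE : (j%:R : R) = n%:R - (n - j)%:R by rewrite natrB//; ring.
    have mE : ((n - t)%:R : R) = n%:R - t%:R by rewrite natrB// ltnW.
    have : a j + (n - j)%:R * - rho <= a n - 2 * D.
      apply: (@tent_slope s K D n%:R (n - t)%:R) => //.
      - exact: ltW.
      - by rewrite ler1n subn_gt0.
      - by rewrite ler_nat leq_sub2l// ltnW.
      - by rewrite ler_nat leq_subr.
      - apply: le_trans (hj j _ jt xj) _; first by rewrite jln (leq_trans _ tj).
        by rewrite ler_wpM2r// ler_nat geq_minr.
    rewrite -/s jE; move: hr1; rewrite mE; nra.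
  rewrite leq_eqVlt (negbTE jt)/= => jlt.
  have : j%:R + 1 <= (t%:R : R) by rewrite natr1 ler_nat.
  have := xjs j jn jt xj; rewrite -/s; nra.
have norm1_lt u : u \in w1 -> normc u <= 1 / 4.
  move=> /norm_w1 h; rewrite (le_trans h)// exp2D.
  have : dlt * dlt <= dlt * (1 / 4) by rewrite ler_wpM2l//; lra.
  lra.
have norm2_gt u : u \in w2 -> 1 <= normc u.
  by move=> /norm_w2; apply: le_trans; apply: le_trans (expR_ge1Dx _); lra.
have dne : {in w1, forall u, u \notin w2}.
  move=> u /norm1_lt u1; apply/negP => /norm2_gt; lra.
have uniq12 : uniq (wseq x n t).
  rewrite /wseq cat_uniq -/w1 -/w2 !uniq_roots_binomial// andbT/=.
  apply/hasPn => u u2; apply/negP => u1; move: (dne _ u1); by rewrite u2.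
have sep : {in wseq x n t &, forall u v, u != v ->
    dlt * normc u + dlt * normc v <= normc (u - v)}.
  have cross u v : u \in w1 -> v \in w2 -> dlt * normc u + dlt * normc v <= normc (v - u).
    move=> /norm1_lt u1 /norm2_gt v1; apply: le_trans (lerB_normc _ _).
    have dv : 4 * dlt * normc v <= 1 * normc v by rewrite ler_wpM2r ?normc_ge0.
    have du : 4 * dlt * normc u <= 1 * normc u by rewrite ler_wpM2r ?normc_ge0.
    have := normc_ge0 u; lra.
  have same m (c u v : R[i]) : (0 < m <= n)%N -> u ^+ m = c -> v ^+ m = c -> u != v ->
      dlt * normc u + dlt * normc v <= normc (u - v).
    move=> /andP[m0 mn] uc vc uv; have hu := pow_eq_separated m0 uc vc uv.
    have hv : normc v <= m%:R * normc (u - v).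
      by rewrite normcBC; apply: (pow_eq_separated m0 vc uc); rewrite eq_sym.
    have mnR : (m%:R : R) <= n%:R by rewrite ler_nat.
    have d0 := normc_ge0 (u - v).
    have hmn : m%:R * normc (u - v) <= n%:R * normc (u - v) by rewrite ler_wpM2r.
    have : dlt * (4 * n%:R) * normc (u - v) <= normc (u - v).
      by rewrite ler_piMl// mulrC.
    have : dlt * normc u <= dlt * (m%:R * normc (u - v)) by rewrite ler_wpM2l.
    have : dlt * normc v <= dlt * (m%:R * normc (u - v)) by rewrite ler_wpM2l.
    have : dlt * (m%:R * normc (u - v)) <= dlt * (n%:R * normc (u - v)).
      by rewrite ler_wpM2l.
    lra.
  move=> u v; rewrite /wseq !mem_cat -/w1 -/w2 => /orP[] hu /orP[] hv uv.
  - apply: (same t (- x 0%N / x t)) => //; first by rewrite t0 (ltnW tn).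
      by rewrite -(mem_roots_binomial xt hu) mulrC mulKf.
    by rewrite -(mem_roots_binomial xt hv) mulrC mulKf.
  - by rewrite normcBC; apply: cross.
  - by rewrite addrC; apply: cross.
  - apply: (same (n - t)%N (- x t / x n)) => //; first by rewrite nt0 leq_subr.
      by rewrite -(mem_roots_binomial xn hu) mulrC mulKf.
    by rewrite -(mem_roots_binomial xn hv) mulrC mulKf.
have sws : size (wseq x n t) = n by rewrite size_cat sw1 sw2 subnKC// ltnW.
split.
- move=> k [kn kmax]; apply/eqP; apply: contraT => kt.
  have xk : x k != 0.
    by rewrite -normc_gt0 (lt_le_trans _ (kmax t (ltnW tn)))// normc_gt0.
  have := xjs k kn kt xk; rewrite ltNge /s /a ler_ln ?posrE ?normc_gt0//.
  by rewrite kmax// ltnW.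
- have [| |z zr hz] := @match_roots _ n (roots_of (Gpoly x n)) _ dlt sws _ uniq12 _ sep.
  + by rewrite size_roots_of ?Gpoly_neq0 ?size_Gpoly.
  + by move=> w; rewrite mem_cat => /orP[/near1|/near2].
  exists z => // k; apply: lt_le_trans (hz k) _.
  by rewrite ler_wpM2r ?normc_ge0// ler_expR lerN2.
- move=> k; rewrite /wroot /wseq nth_cat -/w1 -/w2 sw1.
  case: ltnP => kt.
    apply: (@le_lt_trans _ _ (expR (- (2 * D)))); last by rewrite ltr_expR; lra.
    by apply: norm_w1; rewrite mem_nth ?sw1.
  apply: (@lt_le_trans _ _ (expR (2 * D))); first by rewrite ltr_expR; lra.
  by apply: norm_w2; rewrite mem_nth ?sw2// ltn_sub2r// (leq_ltn_trans kt).
Qed.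

End DominantCoefficient.

(** * Continuity of roots *)

Section ContinuityOfRoots.
Context (R : realType).
Implicit Types (p q f : {poly R[i]}) (a c z : R[i]).

(** Synthetic division: f_k = g_(k+1) + a f_(k+1) for g = (X - a) f, so the
    coefficients of f are controlled from the top down. This makes deflation by
    a root a stable operation. *)
Lemma factor_coef_bound m (B : R) : 0 <= B -> exists2 C, 0 < C &
  forall f a (eta : R), (size f <= m)%N -> normc a <= B -> 0 <= eta ->
    (forall k, normc (('X - a%:P) * f)`_k <= eta) ->
    forall k, normc f`_k <= C * eta.
Proof.
move=> B0; pose c j := iter j (fun u : R => 1 + B * u) 0.
have c0 j : 0 <= c j by elim: j => //= j IH; rewrite addr_ge0// mulr_ge0.
exists (1 + c m); first by rewrite ltr_pwDl.
move=> f a eta sf aB eta0 h k.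
have claim j i : (m <= i + j)%N -> normc f`_i <= c j * eta.
  elim: j i => [|j IH] i mij.
    by rewrite addn0 in mij; rewrite nth_default ?normc0 ?mul0r// (leq_trans sf).
  have -> : f`_i = (('X - a%:P) * f)`_i.+1 + a * f`_i.+1.
    by rewrite mulrBl coefB coefXM coefCM/= subrK.
  rewrite (le_trans (normcD _ _))// (_ : c j.+1 = 1 + B * c j)// (mulrDl 1) mul1r lerD// normcM -mulrA.
  rewrite (le_trans (ler_wpM2r (normc_ge0 _) aB))// ler_wpM2l// IH//.
  by rewrite addSnnS.
apply: le_trans (claim m k _) _; first by rewrite leq_addl.
by rewrite ler_wpM2r// lerDr.
Qed.

Lemma normc_horner_prod_ge (s : seq R[i]) w (r : R) : 0 <= r ->
  (forall z, z \in s -> r <= normc (w - z)) ->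
  r ^+ size s <= normc (\prod_(z <- s) ('X - z%:P)).[w].
Proof.
move=> r0; elim: s => [_|a s IH h]; first by rewrite big_nil hornerC normc1.
rewrite big_cons hornerM hornerXsubC normcM exprS ler_pM ?exprn_ge0//.
  by rewrite h ?mem_head.
by apply: IH => z zs; rewrite h// in_cons zs orbT.
Qed.

Lemma normc_horner_le n q (d : R) w : (size q <= n)%N ->
  (forall k, normc q`_k <= d) -> normc q.[w] <= d * \sum_(k < n) normc w ^+ k.
Proof.
move=> sq h; rewrite (horner_coef_wide w sq) mulr_sumr.
apply: le_trans (normc_sum _ _ _) _; apply: ler_sum => k _.
by rewrite normcM normcX ler_wpM2r// exprn_ge0// normc_ge0.
Qed.

(** By deflation. If q is close to P = (X - a) P1, then q(a) is small, so q
    has a root a' near a; then q / (X - a') is close to P1 by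
    [factor_coef_bound] and the induction hypothesis applies. *)
Lemma roots_continuous (c : R[i]) (s : seq R[i]) (e : R) : c != 0 -> 0 < e ->
  exists2 d, 0 < d & forall q, (size q <= (size s).+1)%N ->
    (forall k, normc (q`_k - (c *: \prod_(z <- s) ('X - z%:P))`_k) <= d) ->
    exists s', [/\ size s' = size s, perm_eq s' (roots_of q) &
      forall k, (k < size s)%N -> normc (nth 0 s' k - nth 0 s k) < e].
Proof.
move=> c0; elim: s e => [|a s IH] e e0.
  exists 1 => // q sq _; exists [::]; split => //.
  by rewrite (size1_polyC sq) roots_of_const.
have [d1 d10 {}IH] := IH e e0.
set P1 := c *: \prod_(z <- s) _ in IH.
set n := size s.
have cE : P1`_n = c.
  have := @lead_coef_prod_XsubC R[i] _ s xpredT id.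
  by rewrite lead_coefE size_prod_XsubC/= coefZ => ->; rewrite mulr1.
have nc : 0 < normc c by rewrite normc_gt0.
have [C C0 hC] := @factor_coef_bound n.+1 (normc a + 1) (addr_ge0 (normc_ge0 _) ler01).
pose M := \sum_(k < n.+1) normc P1`_k.
have sP1 : size P1 = n.+1 by rewrite size_scale// size_prod_XsubC.
have P10 : P1 != 0 by rewrite -size_poly_eq0 sP1.
have M0 : 0 <= M by apply: sumr_ge0 => k _; exact: normc_ge0.
have hM k : normc P1`_k <= M.
  have [kn|nk] := ltnP k n.+1; last by rewrite nth_default ?sP1// normc0.
  by rewrite /M (bigD1 (Ordinal kn))//= lerDl sumr_ge0// => i _; exact: normc_ge0.
pose W : R := \sum_(k < n.+2) normc a ^+ k.
have W0 : 0 < W.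
  rewrite /W big_ord_recl expr0 ltr_pwDl// sumr_ge0// => i _.
  by rewrite exprn_ge0// normc_ge0.
(* e' bounds the displacement of the root a that is divided out; d then makes
   |q(a)| too small for all roots of q to be at distance e' from a. *)
pose e' := Num.min (Num.min e 1) (d1 / (2 * C * (M + 1))).
have e'0 : 0 < e' by rewrite !lt_min e0 ltr01/= divr_gt0// !mulr_gt0// ltr_pwDr.
have e'e : e' <= e by rewrite !ge_min lexx.
have e'1 : e' <= 1 by rewrite !ge_min lexx orbT.
have e'C : 2 * C * (M * e') <= d1.
  have : e' <= d1 / (2 * C * (M + 1)) by rewrite ge_min lexx orbT.
  rewrite ler_pdivlMr; last by rewrite !mulr_gt0// ltr_pwDr.
  have : 0 <= e' * (2 * C) by rewrite !mulr_ge0// ltW.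
  lra.
pose d := Num.min (Num.min (normc c / 2) (d1 / (2 * C))) (normc c / 4 * e' ^+ n.+1 / W).
have d0 : 0 < d by rewrite !lt_min !divr_gt0// ?mulr_gt0// ?divr_gt0// exprn_gt0.
have dc : d <= normc c / 2 by rewrite !ge_min lexx.
have dC : 2 * C * d <= d1.
  have : d <= d1 / (2 * C) by rewrite !ge_min lexx orbT.
  by rewrite ler_pdivlMr ?mulr_gt0// mulrC.
have dW : d * W <= normc c / 4 * e' ^+ n.+1.
  by rewrite -ler_pdivlMr// ge_min lexx orbT.
exists d => // q sq hq.
set P := c *: _ in hq.
have PE : P = ('X - a%:P) * P1 by rewrite /P big_cons scalerAr.
have Pn1 : P`_n.+1 = c.
  rewrite PE mulrBl coefB coefXM coefCM/= cE (nth_default _ _) ?sP1//.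
  by rewrite mulr0 subr0.
have qn : normc c / 2 <= normc q`_n.+1.
  have := hq n.+1; rewrite Pn1 normcBC => h.
  have := lerB_normc c (c - q`_n.+1); rewrite subKr; lra.
have qn0 : q`_n.+1 != 0 by rewrite -normc_gt0; lra.
have q0 : q != 0 by apply: contraNneq qn0 => ->; rewrite coef0.
have sqE : size q = n.+2.
  apply/eqP; rewrite eqn_leq sq ltnNge; apply: contra qn0 => h.
  by rewrite nth_default.
have lq : lead_coef q = q`_n.+1 by rewrite lead_coefE sqE.
have [a' a'q a'a] : exists2 a', a' \in roots_of q & normc (a - a') < e'.
  have [//|no] := pselect (exists2 a', a' \in roots_of q & normc (a - a') < e').
  have far z : z \in roots_of q -> e' <= normc (a - z).
    by move=> zr; rewrite leNgt; apply/negP => zw; apply: no; exists z.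
  have := normc_horner_prod_ge (ltW e'0) far; rewrite size_roots_of// sqE/= => lo.
  have hi : normc q.[a] <= d * W.
    have -> : q.[a] = (q - P).[a].
      by rewrite hornerD hornerN PE hornerM hornerXsubC subrr mul0r subr0.
    apply: normc_horner_le => [|k]; last by rewrite coefB.
    apply: leq_trans (size_polyD _ _) _; rewrite geq_max sqE leqnn size_polyN PE.
    by rewrite size_monicM ?monicXsubC// size_XsubC sP1; exact: leqnn.
  have : normc q.[a] = normc q`_n.+1 * normc (\prod_(z <- roots_of q) ('X - z%:P)).[a].
    by rewrite {1}(roots_ofE q) hornerZ normcM lq.
  have e'n : 0 < e' ^+ n.+1 by rewrite exprn_gt0.
  have : normc c / 2 * e' ^+ n.+1 <= normc q`_n.+1 * normc (\prod_(z <- roots_of q) ('X - z%:P)).[a].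
    by apply: ler_pM => //; [lra|exact: ltW].
  have : 0 < normc c * e' ^+ n.+1 by rewrite mulr_gt0.
  lra.
have /factor_theorem[q1] : root q a' by rewrite -mem_roots_of.
rewrite mulrC => qE.
have q10 : q1 != 0 by apply: contraNneq q0 => h; rewrite qE h mulr0.
have sq1 : size q1 = n.+1.
  by apply: succn_inj; rewrite -sqE qE size_monicM ?monicXsubC// size_XsubC.
have na' : normc a' <= normc a + 1.
  have := lerB_normc a' a; rewrite normcBC; lra.
have close1 k : normc (q1`_k - P1`_k) <= d1.
  have := hC (q1 - P1) a' (d + M * e') _ na' _ _ k; rewrite coefB.
  move=> /(_ _ _ _) h; apply: le_trans (h _ _ _) _.
  - apply: leq_trans (size_polyD _ _) _.
    by rewrite geq_max size_polyN sq1 sP1 leqnn.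
  - by apply: addr_ge0; [exact: ltW|apply: mulr_ge0 => //; exact: ltW].
  - move=> i.
    have -> : ('X - a'%:P) * (q1 - P1) = (q - P) + (a' - a)%:P * P1.
      by rewrite qE PE polyCB; ring.
    rewrite coefD coefB coefCM; apply: le_trans (normcD _ _) _; apply: lerD; first exact: hq.
    rewrite normcM normcBC mulrC; apply: ler_pM => //; rewrite ?normc_ge0//.
    exact: ltW.
  - lra.
have [|s' [ss' ps' hs']] := IH q1 _ close1; first by rewrite sq1.
exists (a' :: s'); split.
- by rewrite /= ss'.
- have := @perm_roots_ofM R ('X - a'%:P) q1; rewrite polyXsubC_eq0 -qE => /(_ isT q10).
  rewrite perm_sym => /(perm_trans _); apply.
  rewrite -cat1s; apply: perm_cat => //.
  have := @perm_roots_of R 1 [:: a'] (oner_neq0 _).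
  by rewrite big_seq1 scale1r perm_sym.
- move=> [|k]/= hk; last exact: hs'.
  by rewrite normcBC (lt_le_trans a'a).
Qed.

End ContinuityOfRoots.

(** * Measurability of the good event *)

Section MeasurableOpen.
Context (R : realType).

Lemma normc_le_ReIm (z : R[i]) : normc z <= `|complex.Re z| + `|complex.Im z|.
Proof.
case: z => a b /=; rewrite -[leRHS]ger0_norm ?addr_ge0// -sqrtr_sqr.
rewrite ler_sqrt ?sqr_ge0// sqrrD !real_normK ?num_real//.
have : 0 <= `|a| * `|b| by rewrite mulr_ge0.
lra.
Qed.

Lemma exists_pos_lower_bound m (F : 'I_m -> R) : (forall i, 0 < F i) ->
  exists2 e, 0 < e & forall i, e <= F i.
Proof.
move=> F0; exists (\big[Num.min/1]_(i < m) F i).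
  by elim/big_ind : _ => // u v u0 v0; rewrite lt_min u0.
by move=> i; rewrite (bigD1 i)//= ge_min lexx.
Qed.

Context d (T : measurableType d) (X : nat -> T -> R[i]).
Hypothesis mX : forall k, measurable_fun setT (fun w => reim (X k w)).

Lemma measurable_Re k : measurable_fun setT (fun w => complex.Re (X k w) : measurableTypeR R).
Proof. by have := measurableT_comp measurable_fst (mX k). Qed.

Lemma measurable_Im k : measurable_fun setT (fun w => complex.Im (X k w) : measurableTypeR R).
Proof. by have := measurableT_comp measurable_snd (mX k). Qed.

(** An open condition on finitely many coordinates is a countable union of
    boxes with rational centre and inverse-integer size. *)
Lemma measurable_open_coordinates n (U : set (nat -> R[i])) :
  (forall x, U x -> exists2 e, 0 < e &
     forall y, (forall k, (k <= n)%N -> normc (y k - x k) < e) -> U y) ->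
  measurable [set w | U (X^~ w)].
Proof.
move=> openU.
pose box (i : {ffun 'I_n.+1 -> rat * rat} * nat) (x : nat -> R[i]) :=
  forall k : 'I_n.+1, `|complex.Re (x k) - ratr (i.1 k).1| < i.2.+1%:R^-1 /\
                      `|complex.Im (x k) - ratr (i.1 k).2| < i.2.+1%:R^-1.
pose F i := [set w | (forall y, box i y -> U y) /\ box i (X^~ w)].
rewrite (_ : [set w | _] = \bigcup_i F i); last first.
  apply/seteqP; split => w /=; last by move=> [i _ [hU hw]]; exact: hU.
  move=> /openU[e e0 he].
  have [r hr] : exists r : nat, r.+1%:R^-1 * 4 < e.
    exists (archimedean.Num.bound (4 / e)).
    rewrite mulrC ltr_pdivrMr// mulrC -ltr_pdivrMr//.
    apply: lt_le_trans (archimedean.Num.Theory.archi_boundP _) _; first by rewrite divr_ge0// ltW.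
    by rewrite ler_nat.
  have approx (a : R) : exists q : rat, `|a - ratr q| < r.+1%:R^-1.
    have /rat_in_itvoo[q] : a < a + r.+1%:R^-1 by rewrite ltrDl invr_gt0.
    rewrite inE/= => /andP[h1 h2]; exists q.
    by rewrite distrC ger0_norm ?subr_ge0 ?ltW// ltrBlDl.
  pose q := [ffun k : 'I_n.+1 => (sval (cid (approx (complex.Re (X k w)))),
                                 sval (cid (approx (complex.Im (X k w)))))].
  have bq : box (q, r) (X^~ w).
    by move=> k; rewrite /= ffunE/=; split; case: cid.
  exists (q, r) => //; split => // y by_; apply: he => k kn.
  have /= [y1 y2] := by_ (Ordinal (kn : (k < n.+1)%N)).
  have /= [x1 x2] := bq (Ordinal (kn : (k < n.+1)%N)).
  have ReB (a b : R[i]) : complex.Re (a - b) = complex.Re a - complex.Re b by case: a b => ? ? [].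
  have ImB (a b : R[i]) : complex.Im (a - b) = complex.Im a - complex.Im b by case: a b => ? ? [].
  apply: le_lt_trans (normc_le_ReIm _) _; rewrite ReB ImB.
  apply: le_lt_trans hr.
  have tri (a b c g : R) : `|a - c| < g -> `|b - c| < g -> `|a - b| <= g + g.
    move=> h1 h2; rewrite (_ : a - b = (a - c) - (b - c)); last by ring.
    by rewrite (le_trans (ler_normB _ _))// lerD// ltW.
  have := lerD (tri _ _ _ _ y1 x1) (tri _ _ _ _ y2 x2); move/le_trans; apply.
  by move: (_^-1) => g; lra.
apply: countable_bigcupT_measurable; first exact: countableP.
move=> i; have [hU|nU] := pselect (forall y, box i y -> U y); last first.
  by rewrite (_ : F i = set0)//; apply/seteqP; split => w //= -[].
pose J (q : rat) : set (measurableTypeR R) :=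
  [set` `]ratr q - i.2.+1%:R^-1, ratr q + i.2.+1%:R^-1[%R].
have JE q (u : R) : J q u = (`|u - ratr q| < i.2.+1%:R^-1).
  by rewrite /J/= in_itv/= ltr_distl.
rewrite (_ : F i = \bigcap_(k < n.+1)
    ((fun w => complex.Re (X k w)) @^-1` J (i.1 (inord k)).1 `&`
     (fun w => complex.Im (X k w)) @^-1` J (i.1 (inord k)).2)).
  apply: bigcap_measurable => [|k _]; first by exists 0%N.
  apply: measurableI; rewrite -[X in measurable X]setTI.
    by apply: measurable_Re => //; exact: measurable_itv.
  by apply: measurable_Im => //; exact: measurable_itv.
apply/seteqP; split => w /=.
  move=> [_ bw] k /= kn; have := bw (inord k).
  by rewrite inordK// !JE.
move=> h; split => // k; have /= := h k (ltn_ord k).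
by rewrite inord_val !JE.
Qed.

Lemma measurable_normc k : measurable_fun setT (fun w => normc (X k w) : measurableTypeR R).
Proof.
rewrite (_ : (fun _ => _) =
    (@Num.sqrt R : measurableTypeR R -> measurableTypeR R) \o
    (fun w => complex.Re (X k w) ^+ 2 + complex.Im (X k w) ^+ 2)); last first.
  by apply/funext => w /=; case: (X k w).
apply: measurableT_comp; first exact: continuous_measurable_fun (@sqrt_continuous R).
apply: measurable_funD; apply: measurable_funX; [exact: measurable_Re|exact: measurable_Im].
Qed.

End MeasurableOpen.

Section GoodEventMeasurable.
Context (R : realType).
Implicit Types (x y : nat -> R[i]) (A : R).

(** The product of the two binomials: the numbers w are the roots of a single
    polynomial of degree n whose coefficients are continuous in x. *)
Definition wpoly x n t : {poly R[i]} :=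
  (x t *: 'X^t + (x 0%N)%:P) * (x n *: 'X^(n - t) + (x t)%:P).

(** The numbering of the w's is immaterial: a permutation matching a given
    enumeration with [wseq] can be applied to the z's as well. *)
Lemma roots_close_perm A x n t (zs us : seq R[i]) :
  size us = n -> perm_eq zs (roots_of (Gpoly x n)) -> perm_eq us (wseq x n t) ->
  (forall k, (k < n)%N -> normc (nth 0 zs k - nth 0 us k)
     < expR (- (n%:R `^ A)) * normc (nth 0 us k)) ->
  size zs = n -> roots_close A x n t.
Proof.
move=> sus pz pu h szs.
have szs' : size zs == n by rewrite szs.
have sus' : size us == n by rewrite sus.
have : perm_eq (wseq x n t) (Tuple sus') by rewrite perm_sym.
move=> /tuple_permP[s hs].
exists [tuple tnth (Tuple szs') (s i) | i < n].
  have pzs : perm_eq [tuple tnth (Tuple szs') (s i) | i < n] (Tuple szs').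
    by apply/tuple_permP; exists s.
  exact: perm_trans pzs pz.
move=> k; rewrite tnth_mktuple /wroot hs.
rewrite -[nth 0 _ k](tnth_nth 0 _ k) tnth_mktuple.
rewrite !(tnth_nth 0)/=; exact: h.
Qed.

Lemma size_wseq x n t : (t <= n)%N -> x n != 0 -> x t != 0 -> size (wseq x n t) = n.
Proof.
by move=> tn xn xt; rewrite /wseq size_cat !size_roots_binomial// subnKC.
Qed.

Lemma coef_wpoly x n t k : (t <= n)%N -> (wpoly x n t)`_k =
   x t * x n * (k == n)%:R + x t * x t * (k == t)%:R +
   x 0%N * x n * (k == n - t)%N%:R + x 0%N * x t * (k == 0)%N%:R.
Proof.
move=> tn.
have -> : wpoly x n t = (x t * x n) *: 'X^n + (x t * x t) *: 'X^t +
    (x 0%N * x n) *: 'X^(n - t) + (x 0%N * x t)%:P.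
  rewrite /wpoly (_ : 'X^n = 'X^t * 'X^(n - t)); last by rewrite -exprD subnKC.
  rewrite -!mul_polyC !polyCM; ring.
by rewrite !coefD !coefZ !coefXn coefC; case: (k == 0)%N; rewrite ?mulr1 ?mulr0.
Qed.

Lemma wpoly_factors_neq0 x n t : (t <= n)%N -> x n != 0 -> x t != 0 ->
  x t *: 'X^t + (x 0%N)%:P != 0 /\ x n *: 'X^(n - t) + (x t)%:P != 0.
Proof.
have factor_neq0 (a b : R[i]) m : a != 0 -> (m = 0%N -> a = b) ->
    a *: 'X^m + b%:P != 0.
  move=> a0; case: m => [/(_ erefl) <-|m _]; last exact: binomial_neq0.
  by rewrite expr0 alg_polyC -polyCD polyC_eq0 -mulr2n mulrn_eq0 negb_or a0.
move=> tn xn xt; split; apply: factor_neq0 => //; first by move->.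
by move=> /eqP; rewrite subn_eq0 => nt; congr x; apply/eqP; rewrite eqn_leq nt.
Qed.

Lemma perm_roots_wpoly x n t : (t <= n)%N -> x n != 0 -> x t != 0 ->
  perm_eq (roots_of (wpoly x n t)) (wseq x n t).
Proof. by move=> tn xn xt; have [] := wpoly_factors_neq0 tn xn xt; exact: perm_roots_ofM. Qed.

(** The finitely many strict inequalities leave a positive margin, and both
    the roots of G and those of [wpoly] move by less than a quarter of it. *)
Lemma roots_close_open A x n t : (t <= n)%N -> x t != 0 -> x n != 0 ->
  roots_close A x n t -> exists2 e, 0 < e &
    forall y, (forall k, (k <= n)%N -> normc (y k - x k) < e) ->
    [/\ y t != 0, y n != 0 & roots_close A y n t].
Proof.
move=> tn xt xn [zs pz close].
set dlt := expR _ in close.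
have dlt0 : 0 < dlt by exact: expR_gt0.
have dlt1 : dlt <= 1 by rewrite -expR0 ler_expR oppr_le0 powR_ge0.
set ws := wseq x n t.
have sws : size ws = n by exact: size_wseq.
have szs : size zs = n by exact: size_tuple.
have [e1 e10 he1] := @exists_pos_lower_bound R n
  (fun k => dlt * normc (nth 0 ws k) - normc (tnth zs k - nth 0 ws k))
  (fun k => ltac:(rewrite subr_gt0; exact: close)).
have e4 : 0 < e1 / 4 by rewrite divr_gt0.
have GE : Gpoly x n = lead_coef (Gpoly x n) *: \prod_(z <- zs) ('X - z%:P).
  by rewrite (perm_big _ pz); exact: roots_ofE.
have QE : wpoly x n t = lead_coef (wpoly x n t) *: \prod_(z <- ws) ('X - z%:P).
  rewrite -(perm_big _ (perm_roots_wpoly tn xn xt)); exact: roots_ofE.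
have Gl : lead_coef (Gpoly x n) != 0 by rewrite lead_coef_eq0 Gpoly_neq0.
have Ql : lead_coef (wpoly x n t) != 0.
  by have [h1 h2] := wpoly_factors_neq0 tn xn xt; rewrite lead_coef_eq0 mulf_neq0.
have [d1 d10] := roots_continuous zs Gl e4; rewrite -GE szs => hd1.
have [d2 d20] := roots_continuous ws Ql e4; rewrite -QE sws => hd2.
pose M := \sum_(k < n.+1) normc (x k).
have M0 : 0 <= M by apply: sumr_ge0 => k _; exact: normc_ge0.
have hM k : (k <= n)%N -> normc (x k) <= M.
  move=> kn; rewrite /M (bigD1 (Ordinal (kn : (k < n.+1)%N)))//= lerDl sumr_ge0// => i _.
  exact: normc_ge0.
have M8 : 0 < 4 * (2 * M + 1) by lra.
pose d := Num.min (Num.min d1 1)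
  (Num.min (d2 / (4 * (2 * M + 1))) (Num.min (normc (x t)) (normc (x n)))).
have d0 : 0 < d by rewrite !lt_min d10 ltr01 divr_gt0// !normc_gt0 xt xn.
have dd1 : d <= d1 by rewrite !ge_min lexx.
have d1' : d <= 1 by rewrite !ge_min lexx orbT.
have dd2 : 4 * (d * (2 * M + 1)) <= d2.
  have : d <= d2 / (4 * (2 * M + 1)) by rewrite !ge_min lexx !orbT.
  rewrite ler_pdivlMr//; lra.
have dxt : d <= normc (x t) by rewrite !ge_min lexx !orbT.
have dxn : d <= normc (x n) by rewrite !ge_min lexx !orbT.
exists d => // y hy.
have y_neq0 k : (k <= n)%N -> d <= normc (x k) -> y k != 0.
  move=> kn dk; apply: contraTneq dk => yk0; rewrite -ltNge.
  by have := hy k kn; rewrite yk0 sub0r normcN.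
have yt : y t != 0 by exact: y_neq0.
have yn : y n != 0 by exact: y_neq0.
split => //.
have [| |zs' [szs' pzs' hzs']] := hd1 (Gpoly y n); first exact: size_Gpoly_le.
  move=> k; rewrite !coef_Gpoly; case: leqP => kn; last by rewrite subrr normc0 ltW.
  by rewrite (le_trans (ltW (hy k kn))).
have prod_close i j : (i <= n)%N -> (j <= n)%N ->
    normc (y i * y j - x i * x j) <= d * (2 * M + 1).
  move=> im jn.
  have -> : y i * y j - x i * x j =
      (y i - x i) * (y j - x j) + ((y i - x i) * x j + x i * (y j - x j)) by ring.
  have h1 := hy i im; have h2 := hy j jn.
  have b1 : normc ((y i - x i) * (y j - x j)) <= d * 1.
    rewrite normcM; apply: ler_pM; rewrite ?normc_ge0 ?ltW//.
    exact: lt_le_trans d1'.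
  have b2 : normc ((y i - x i) * x j) <= d * M.
    by rewrite normcM; apply: ler_pM; rewrite ?normc_ge0 ?hM// ltW.
  have b3 : normc (x i * (y j - x j)) <= M * d.
    by rewrite normcM; apply: ler_pM; rewrite ?normc_ge0 ?hM// ltW.
  have := normcD ((y i - x i) * (y j - x j)) ((y i - x i) * x j + x i * (y j - x j)).
  have := normcD ((y i - x i) * x j) (x i * (y j - x j)); lra.
have natb (a : R[i]) (b : bool) (r : R) : normc a <= r -> normc (a * b%:R) <= r.
  move=> ar; case: b; rewrite ?mulr1// mulr0 normc0.
  by rewrite (le_trans (normc_ge0 a)).
have [| |us [sus pus hus]] := hd2 (wpoly y n t).
- apply/leq_sizeP => j nj; rewrite coef_wpoly// gtn_eqF// gtn_eqF ?(leq_ltn_trans tn)//.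
  rewrite gtn_eqF ?(leq_ltn_trans (leq_subr _ _))//.
  by rewrite gtn_eqF ?(leq_ltn_trans (leq0n _) nj)// !mulr0 !addr0.
- move=> k; rewrite !coef_wpoly//.
  set b1 := (k == n)%:R; set b2 := (k == t)%:R; set b3 := (k == _)%:R; set b4 := (_ == _)%:R.
  have -> : y t * y n * b1 + y t * y t * b2 + y 0%N * y n * b3 + y 0%N * y t * b4 -
     (x t * x n * b1 + x t * x t * b2 + x 0%N * x n * b3 + x 0%N * x t * b4) =
     ((y t * y n - x t * x n) * b1 + (y t * y t - x t * x t) * b2) +
     ((y 0%N * y n - x 0%N * x n) * b3 + (y 0%N * y t - x 0%N * x t) * b4) by ring.
  have c1 := natb _ (k == n) _ (prod_close t n tn (leqnn _)).
  have c2 := natb _ (k == t) _ (prod_close t t tn tn).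
  have c3 := natb _ (k == (n - t)%N) _ (prod_close 0%N n (leq0n _) (leqnn _)).
  have c4 := natb _ (k == 0%N) _ (prod_close 0%N t (leq0n _) tn).
  apply: le_trans dd2; apply: le_trans (normcD _ _) _.
  apply: (le_trans (lerD (normcD _ _) (normcD _ _))).
  rewrite -/b1 in c1; rewrite -/b2 in c2; rewrite -/b3 in c3; rewrite -/b4 in c4.
  lra.
apply: (@roots_close_perm A y n t zs' us) => //.
  exact: perm_trans pus (perm_roots_wpoly tn yn yt).
move=> k kn; rewrite -/dlt.
have h1 := hzs' k kn; have h2 := hus k kn; have := he1 (Ordinal kn).
rewrite (tnth_nth 0)/=.
move: h1 h2; set z := nth 0 zs k; set z' := nth 0 zs' k.
set u := nth 0 ws k; set u' := nth 0 us k.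
move=> h1 h2 h3.
have -> : z' - u' = (z' - z) + ((z - u) - (u' - u)) by ring.
have := normcD (z' - z) ((z - u) - (u' - u)); have := normcB (z - u) (u' - u).
have : dlt * (normc u - normc u') <= dlt * (e1 / 4).
  rewrite ler_pM2l//; have := lerB_normc u u'; rewrite normcBC; lra.
have : dlt * (e1 / 4) <= 1 * (e1 / 4) by rewrite ler_pM2r.
lra.
Qed.

(** All roots of a binomial have the same modulus, so the condition depends
    on three moduli of coefficients only. *)
Lemma roots_separatedE A x n t : (t <= n)%N -> x t != 0 -> x n != 0 ->
  roots_separated A x n t <->
  (t = 0%N \/ normc (x 0%N) < normc (x t) * expR (- (n%:R `^ A)) ^+ t) /\
  (t = n \/ normc (x n) * expR (n%:R `^ A) ^+ (n - t) < normc (x t)).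
Proof.
move=> tn xt xn.
set w1 := roots_of (x t *: 'X^t + (x 0%N)%:P).
set w2 := roots_of (x n *: 'X^(n - t) + (x t)%:P).
have sw1 : size w1 = t by exact: size_roots_binomial.
have sw2 : size w2 = (n - t)%N by exact: size_roots_binomial.
have nt0 : normc (x t) > 0 by rewrite normc_gt0.
have nn0 : normc (x n) > 0 by rewrite normc_gt0.
have e1 w : (0 < t)%N -> w \in w1 -> (normc w < expR (- (n%:R `^ A))) =
    (normc (x 0%N) < normc (x t) * expR (- (n%:R `^ A)) ^+ t).
  move=> t0 /(normc_roots_binomial xt) <-.
  by rewrite ltr_pM2l// ltr_pXn2r// nnegrE ?normc_ge0 ?expR_ge0.
have e2 w : (t < n)%N -> w \in w2 -> (expR (n%:R `^ A) < normc w) =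
    (normc (x n) * expR (n%:R `^ A) ^+ (n - t) < normc (x t)).
  move=> tn' /(normc_roots_binomial xn) <-.
  by rewrite ltr_pM2l// ltr_pXn2r ?subn_gt0// nnegrE ?normc_ge0 ?expR_ge0.
have wE (k : 'I_n) : wroot x n t k =
    if (k < t)%N then nth 0 w1 k else nth 0 w2 (k - t)%N.
  by rewrite /wroot /wseq nth_cat -/w1 sw1.
have mem1 (k : 'I_n) : (k < t)%N -> nth 0 w1 k \in w1 by move=> kt; rewrite mem_nth ?sw1.
have mem2 (k : 'I_n) : (t <= k)%N -> nth 0 w2 (k - t)%N \in w2.
  by move=> kt; rewrite mem_nth ?sw2// ltn_sub2r// (leq_ltn_trans kt).
split=> [sep|[h1 h2] k].
  split.
    have [->|t0] := posnP t; [by left|right].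
    have k0 : (0 < n)%N := leq_trans t0 tn.
    have := sep (Ordinal k0); rewrite wE /= t0 e1//.
    exact: (mem1 (Ordinal k0)).
  have [->|nt] := eqVneq t n; [by left|right].
  have tn' : (t < n)%N by rewrite ltn_neqAle nt.
  have := sep (Ordinal tn'); rewrite wE /= ltnn e2//.
  exact: (mem2 (Ordinal tn')).
rewrite wE; case: ltnP => kt.
  case: h1 => [t0|]; first by rewrite t0 in kt.
  by rewrite e1 ?mem1// (leq_ltn_trans _ kt).
case: h2 => [tE|]; first by rewrite tE leqNgt ltn_ord in kt.
by rewrite e2 ?mem2// (leq_ltn_trans kt).
Qed.

(** Closeness requires n roots, hence x_n <> 0. If x_0 = 0 then w = 0 is among
    the w's, and a strict inequality relative to |w| is impossible. *)
Lemma roots_close_neq0 A x n t : (0 < n)%N -> is_max_index x n t ->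
  roots_close A x n t -> [/\ x 0%N != 0, x n != 0 & x t != 0].
Proof.
move=> n0 [tn tmax] [zs pz close].
have szG : size (roots_of (Gpoly x n)) = n by rewrite -(perm_size pz) size_tuple.
have xn : x n != 0.
  have G0 : Gpoly x n != 0.
    by apply: contraTneq n0 => G0; rewrite -szG G0 -polyC0 roots_of_const.
  have sG : size (Gpoly x n) = n.+1.
    have h := size_roots_of G0; rewrite szG in h.
    by apply: (etrans (esym (prednK _))); rewrite -?h// lt0n size_poly_eq0.
  have := G0; rewrite -lead_coef_eq0 lead_coefE sG/= coef_Gpoly leqnn//.
have xt : x t != 0.
  by rewrite -normc_gt0 (lt_le_trans _ (tmax n (leqnn n)))// normc_gt0.
split => //.
have [t0|t0] := posnP t; first by rewrite -t0.
apply/negP => /eqP x00.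
have := close (Ordinal n0); rewrite /wroot /wseq nth_cat size_roots_binomial// t0.
set w := nth 0 _ _.
have : w \in roots_of (x t *: 'X^t + (x 0%N)%:P) by rewrite mem_nth ?size_roots_binomial.
move=> /(mem_roots_binomial xt); rewrite x00 oppr0 => /eqP.
rewrite mulf_eq0 (negbTE xt) expf_eq0 t0/= => /eqP ->.
by rewrite normc0 mulr0 ltNge normc_ge0.
Qed.

Lemma good_degree0 A x t : is_max_index x 0 t ->
  [/\ unique_max x 0 t, roots_close A x 0 t & roots_separated A x 0 t].
Proof.
move=> [t0 _]; have {}t0 : t = 0%N by apply/eqP; rewrite -leqn0.
split; [|exists [tuple]|]; try by case.
  by move=> k [k0 _]; rewrite t0; apply/eqP; rewrite -leqn0.
by rewrite /= /Gpoly big_ord1 expr0 alg_polyC roots_of_const.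
Qed.

Context d (T : measurableType d) (X : nat -> T -> R[i]).
Hypothesis mX : forall k, measurable_fun setT (fun w => reim (X k w)).

(** On the event, tau is the unique maximal index, so the event is a finite
    union over the possible values t of events that no longer involve tau. *)
Lemma measurable_good_event A (tau : nat -> T -> nat) n :
  (forall n w, is_max_index (X^~ w) n (tau n w)) ->
  measurable [set w | [/\ unique_max (X^~ w) n (tau n w),
                 roots_close A (X^~ w) n (tau n w) &
                 roots_separated A (X^~ w) n (tau n w)]].
Proof.
move=> tau_max; case: n => [|n].
  rewrite (_ : [set w | _] = setT)//; apply/seteqP; split => // w _ /=.
  exact: good_degree0.
set m := n.+1; have m0 : (0 < m)%N by [].
pose mu (k : nat) w : measurableTypeR R := normc (X k w).
have mmu k : measurable_fun setT (mu k) by exact: measurable_normc.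
have mlt (f g : T -> measurableTypeR R) : measurable_fun setT f -> measurable_fun setT g ->
    measurable [set w | f w < g w].
  move=> mf mg; have := measurable_fun_ltr mf mg.
  by move=> /(_ measurableT [set true] I); rewrite setTI.
pose V t := [set w | forall k, (k <= m)%N -> k != t -> mu k w < mu t w] `&`
  [set w | 0 < mu 0%N w] `&`
  [set w | [/\ X t w != 0, X m w != 0 & roots_close A (X^~ w) m t]] `&`
  ([set w | t = 0%N \/ mu 0%N w < mu t w * expR (- (m%:R `^ A)) ^+ t] `&`
   [set w | t = m \/ mu m w * expR (m%:R `^ A) ^+ (m - t) < mu t w]).
rewrite (_ : [set w | _] = \bigcup_(t in [set t | (t <= m)%N]) V t).
  apply: bigcup_measurable => t /= tm; apply: measurableI; first apply: measurableI.
  - apply: measurableI; last by apply: (mlt (cst 0) (mu 0%N)) => //; exact: measurable_cst.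
    rewrite (_ : [set w | _] = \bigcap_(k in [set k | (k <= m)%N /\ k != t]) [set w | mu k w < mu t w]).
      have [[k hk]|no] := pselect (exists k, (k <= m)%N /\ k != t).
        by apply: bigcap_measurable => [|j _]; [exists k | exact: mlt].
      rewrite (_ : \bigcap_(k in _) _ = setT) //; apply/seteqP; split => // w _ k hk.
      by exfalso; apply: no; exists k.
    by apply/seteqP; split => w /= h k; [case; exact: h|move=> k1 k2; exact: h].
  - apply: (@measurable_open_coordinates R d T X mX m
      [set x | [/\ x t != 0, x m != 0 & roots_close A x m t]]).
    by move=> x [xt xm xc]; exact: roots_close_open.
  - apply: measurableI.
      have [->|t0] := eqVneq t 0%N.
        by rewrite (_ : [set w | _] = setT)//; apply/seteqP; split => // w _; left.
      rewrite (_ : [set w | _] = [set w | mu 0%N w < mu t w * expR (- (m%:R `^ A)) ^+ t]).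
        apply: (mlt (mu 0%N) (mu t \* cst (expR (- (m%:R `^ A)) ^+ t))) => //.
        by apply: measurable_funM; [exact: mmu|exact: measurable_cst].
      by apply/seteqP; split => w /=; [case=> // tE; rewrite tE in t0|right].
    have [->|t0] := eqVneq t m.
      by rewrite (_ : [set w | _] = setT)//; apply/seteqP; split => // w _; left.
    rewrite (_ : [set w | _] = [set w | mu m w * expR (m%:R `^ A) ^+ (m - t) < mu t w]).
      apply: (mlt (mu m \* cst (expR (m%:R `^ A) ^+ (m - t))) (mu t)) => //.
      by apply: measurable_funM; [exact: mmu|exact: measurable_cst].
    by apply/seteqP; split => w /=; [case=> // tE; rewrite tE eqxx in t0|right].
apply/seteqP; split => w.
  move=> [uniq close sep]; exists (tau m w) => /=; first by have [] := tau_max m w.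
  have [x0 xm xt] := roots_close_neq0 m0 (tau_max m w) close.
  have [tm tmax] := tau_max m w.
  split; last by have [s1 s2] := (@roots_separatedE A (X^~ w) _ _ tm xt xm).1 sep.
  split; last by split.
  split; last by rewrite /= /mu normc_gt0.
  move=> k km kt; rewrite lt_neqAle /mu tmax// andbT.
  apply: contra kt => /eqP e; apply/eqP/uniq; split=> // j jm.
  by rewrite e; exact: tmax.
move=> [t /= tm [[[umax x0] [xt xm close]] sep]].
have tE : tau m w = t.
  have [tm' tmax'] := tau_max m w; apply/eqP; apply: contraT => ne.
  by have := umax _ tm' ne; rewrite ltNge /mu tmax'.
rewrite tE; split => //; last by apply: (@roots_separatedE A (X^~ w) _ _ tm xt xm).2.
move=> k [km kmax]; apply/eqP; apply: contraT => ne.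
by have := umax _ km ne; rewrite ltNge /mu kmax.
Qed.

End GoodEventMeasurable.

(** * Slowly varying tails *)

Section SlowlyVaryingTail.
Context (R : realType) (F : R -> R).
Hypothesis F_mono : forall x y, x <= y -> F y <= F x.
Hypothesis F_gt0 : forall t, 0 < F t.
Hypothesis F_le1 : forall t, F t <= 1.
Hypothesis F_vanish : forall eta, 0 < eta -> exists t, F t < eta.
Hypothesis F_sv : forall lam, 0 < lam -> F (lam * t) / F t @[t --> +oo] --> (1 : R).

Lemma sv_close lam eps : 0 < lam -> 0 < eps -> exists2 r0, 0 < r0 &
  forall r, r0 <= r -> `|F (lam * r) - F r| <= eps * F r.
Proof.
move=> lam0 eps0; have /cvgrPdist_le/(_ eps eps0)[M [_ hM]] := F_sv lam0.
exists (Num.max 1 (M + 1)); first by rewrite lt_max ltr01.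
move=> r; rewrite ge_max => /andP[r1 rM].
have /hM /= : M < r by apply: lt_le_trans rM; rewrite ltrDl.
rewrite -(ler_pM2r (F_gt0 r)) -{2}(gtr0_norm (F_gt0 r)) -normrM mulrBl mul1r.
by rewrite divfK ?gt_eqF// distrC.
Qed.

(** Keeps (1 + x)^p below 2 as soon as p x <= 1/2. *)
Lemma exprD1_mul_le1 p (x : R) : 0 <= x -> (1 + x) ^+ p * (1 - p%:R * x) <= 1.
Proof.
move=> x0; elim: p => [|p IH]; first by rewrite expr0 mul0r subr0 mul1r.
apply: le_trans IH; rewrite exprSr -mulrA ler_wpM2l//.
  by rewrite exprn_ge0// addr_ge0.
rewrite -natr1; have : 0 <= p%:R * (x * x) by rewrite !mulr_ge0.
have : 0 <= x * x by rewrite mulr_ge0.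
nra.
Qed.

(** Potter's bound in the form F(x) <= C' (r/x)^(1/p) F(r), raised to the
    power p to avoid roots. Halving the argument changes F^p by a factor at most
    2 beyond x0, which is compensated by the factor r; below x0 one uses F <= 1. *)
Lemma potter_bound p : exists2 C, 0 < C & exists2 x0, 0 < x0 &
  forall x r, 0 < x -> x <= r -> x0 <= r -> x * F x ^+ p <= C * (r * F r ^+ p).
Proof.
have eps0 : (0 : R) < (2 * p.+1%:R)^-1 by rewrite invr_gt0 mulr_gt0.
have half0 : (0 : R) < 2^-1 by rewrite invr_gt0.
have [x0 x00 hx0] := sv_close half0 eps0.
set eps := _^-1 in eps0 hx0.
have half r : x0 <= r -> F (2^-1 * r) ^+ p <= 2 * F r ^+ p.
  move=> rx; have := hx0 r rx; rewrite ler_norml => /andP[_ h].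
  have h1 : F (2^-1 * r) <= (1 + eps) * F r by rewrite mulrDl mul1r; lra.
  apply: (@le_trans _ _ (((1 + eps) * F r) ^+ p)).
    by rewrite lerXn2r ?nnegrE ?mulr_ge0 ?addr_ge0 ?(ltW (F_gt0 _)) ?(ltW eps0).
  rewrite exprMn ler_wpM2r ?exprn_ge0 ?(ltW (F_gt0 _))//.
  have := exprD1_mul_le1 p (ltW eps0).
  have pe : p%:R * eps <= 2^-1.
    rewrite /eps ler_pdivrMr ?mulr_gt0// mulrA mulVf// mul1r ler_nat//.
  have e1 : 0 <= (1 + eps) ^+ p by rewrite exprn_ge0// addr_ge0// ltW.
  have : (1 + eps) ^+ p * 2^-1 <= (1 + eps) ^+ p * (1 - p%:R * eps).
    by rewrite ler_wpM2l//; lra.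
  lra.
have Fp r : 0 < F r ^+ p by rewrite exprn_gt0.
have Fp1 r : F r ^+ p <= 1 by rewrite exprn_ile1// ltW.
exists (2 / F (2 * x0) ^+ p); first by rewrite divr_gt0.
set C := _ / _.
have C2 : 2 <= C by rewrite /C ler_pdivlMr// ler_piMr.
have C0 : 0 < C by lra.
exists x0 => // x r x_gt0 xr x0r.
have [k hk] : exists k : nat, r < 2 ^+ k * x0.
  have [k hk] : exists k : nat, r / x0 < k%:R.
    exists (archimedean.Num.bound (r / x0)).
    apply: archimedean.Num.Theory.archi_boundP.
    by rewrite divr_ge0// ltW// (lt_le_trans x00).
  exists k; rewrite -ltr_pdivrMr//; apply: lt_le_trans hk _.
  by rewrite -natrX ler_nat ltnW// ltn_expl.
elim: k x r x_gt0 xr x0r hk => [|k IH] x r x_gt0 xr x0r.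
  by rewrite expr0 mul1r ltNge x0r.
move=> hk; have r0 : 0 < r by exact: lt_le_trans xr.
have [r2|r2] := ltP r (2 * x0).
  apply: (@le_trans _ _ (r * 1)); first by apply: ler_pM => //; exact: ltW.
  rewrite mulr1 mulrCA ler_peMr ?(ltW r0)//.
  apply: (@le_trans _ _ (C * F (2 * x0) ^+ p)).
    by rewrite divfK ?gt_eqF//; lra.
  rewrite ler_wpM2l ?(ltW C0)//.
  by rewrite lerXn2r ?nnegrE ?(ltW (F_gt0 _))// F_mono// ltW.
have hr := half r x0r.
have [xr2|xr2] := leP x (2^-1 * r).
  apply: (@le_trans _ _ (C * (2^-1 * r * F (2^-1 * r) ^+ p))).
    by apply: IH => //; [lra|move: hk; rewrite exprS; lra].
  rewrite ler_pM2l//; have : r * F (2^-1 * r) ^+ p <= r * (2 * F r ^+ p).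
    by rewrite ler_pM2l.
  lra.
apply: (@le_trans _ _ (r * (2 * F r ^+ p))).
  apply: ler_pM => //; [exact: ltW|exact: ltW|].
  apply: le_trans hr; rewrite lerXn2r ?nnegrE ?(ltW (F_gt0 _))// F_mono// ltW//.
by rewrite mulrCA ler_wpM2r// mulr_ge0 ?ltW.
Qed.

(** If u_j <= (b/j)^(1/2) then the sum of the u_j is at most 2 (b J)^(1/2);
    squares avoid the square roots. *)
Lemma sum_le_of_sqr (u : nat -> R) (b : R) J : 0 <= b -> (forall j, 0 <= u j) ->
  (forall j, (1 <= j <= J)%N -> u j ^+ 2 * j%:R <= b) ->
  (\sum_(1 <= j < J.+1) u j) ^+ 2 <= 4 * b * J%:R.
Proof.
move=> b0 u0; elim: J => [|J IH] h; first by rewrite big_geq// expr0n/= mulr0.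
rewrite big_nat_recr//=.
have {IH} := IH (fun j hj => h j (ltac:(by case/andP: hj => -> /leqW))).
set S := \sum_(_ <= _ < _) _ => IH.
have := h J.+1; rewrite leqnn andbT => /(_ isT).
set v := u J.+1 => hv.
have S0 : 0 <= S by apply: sumr_ge0 => i _.
have v0 : 0 <= v by exact: u0.
rewrite -natr1; rewrite -natr1 in hv; set j := (J%:R : R) in IH hv *.
have j0 : 0 <= j by rewrite /j.
(* Weighted AM-GM; the induction closes with the constant 4 for the weight
   2 j + 1. *)
have amgm : 2 * S * v * (2 * j + 1) <= S ^+ 2 + ((2 * j + 1) * v) ^+ 2.
  have : 0 <= (S - (2 * j + 1) * v) ^+ 2 by exact: sqr_ge0.
  rewrite !expr2; lra.
have j1 : 0 < (2 * j + 1) * (j + 1) by rewrite mulr_gt0//; lra.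
rewrite -(ler_pM2r j1).
have e1 : (2 * S * v) * ((2 * j + 1) * (j + 1)) <= (S ^+ 2 + ((2 * j + 1) * v) ^+ 2) * (j + 1).
  by rewrite mulrA ler_wpM2r//; lra.
have e2 : S ^+ 2 * ((2 * j + 1) * (j + 1) + (j + 1)) <= 4 * b * j * ((2 * j + 1) * (j + 1) + (j + 1)).
  by rewrite ler_wpM2r//; lra.
have e3 : (v ^+ 2 * (j + 1)) * ((2 * j + 1) + (2 * j + 1) ^+ 2) <= b * ((2 * j + 1) + (2 * j + 1) ^+ 2).
  by rewrite ler_wpM2r// addr_ge0 ?sqr_ge0//; lra.
have -> : (S + v) ^+ 2 * ((2 * j + 1) * (j + 1)) =
   S ^+ 2 * ((2 * j + 1) * (j + 1)) + 2 * S * v * ((2 * j + 1) * (j + 1)) +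
   v ^+ 2 * (j + 1) * (2 * j + 1) by ring.
have : 0 <= b * j by rewrite mulr_ge0.
move: e1 e2 e3; rewrite !exprMn; lra.
Qed.

(** A Riemann sum form of Karamata's theorem. Indices j <= kap n contribute
    little by [potter_bound] with p = 2, since the sum of j^(-1/2) over j <= kap n
    is of order (kap n)^(1/2). For the others all arguments are within a bounded
    factor of r, and slow variation makes each difference small. *)
Lemma karamata_sum eps : 0 < eps -> exists2 r0, 0 < r0 & forall r n, r0 <= r -> (0 < n)%N ->
  \sum_(1 <= j < n) (F (j%:R * r / (2 * n%:R)) - F (2 * r)) <= eps * (n%:R * F r).
Proof.
move=> eps0; have [C C0 [x0 x00 hC]] := potter_bound 2.
(* Chosen so that the square 8 C kap n^2 of the bound on the sum over
   j <= kap n is at most (eps n / 2)^2. *)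
pose kap := Num.min (2^-1) (eps ^+ 2 / (32 * C)).
have kap0 : 0 < kap by rewrite lt_min invr_gt0 ltr0n divr_gt0 ?exprn_gt0 ?mulr_gt0.
have kap1 : kap <= 2^-1 by rewrite ge_min lexx.
have kapC : 32 * C * kap <= eps ^+ 2.
  have : kap <= eps ^+ 2 / (32 * C) by rewrite ge_min lexx orbT.
  by rewrite ler_pdivlMr ?mulr_gt0// mulrC.
have e4 : 0 < eps / 4 by rewrite divr_gt0.
have two0 : (0 : R) < 2 by [].
have [r1 r10 h1] := sv_close (divr_gt0 kap0 two0) e4.
have [r2 r20 h2] := sv_close two0 e4.
exists (Num.max x0 (Num.max r1 r2)); first by rewrite lt_max x00.
move=> r n; rewrite !ge_max => /andP[rx0 /andP[rr1 rr2]] n0.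
have r0 : 0 < r by exact: lt_le_trans rx0.
have nR : (0 : R) < n%:R by rewrite ltr0n.
have Fr := F_gt0 r.
pose J := archimedean.Num.truncn (kap * n%:R).
have kn0 : 0 <= kap * n%:R by rewrite mulr_ge0 ?ltW.
have /andP[Jle Jgt] : J%:R <= kap * n%:R < J.+1%:R by exact: archimedean.Num.Theory.truncn_itv.
have Jn : (J < n)%N.
  rewrite -(ltr_nat R); apply: le_lt_trans Jle _.
  by rewrite -[ltRHS]mul1r ltr_pM2r//; lra.
rewrite (@big_cat_nat _ _ _ J.+1)//=.
have part1 : \sum_(1 <= j < J.+1) (F (j%:R * r / (2 * n%:R)) - F (2 * r)) <= eps / 2 * (n%:R * F r).
  pose u (j : nat) := F (j%:R * r / (2 * n%:R)) / F r.
  have u0 j : 0 <= u j by rewrite divr_ge0// ltW.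
  apply: (@le_trans _ _ (\sum_(1 <= j < J.+1) u j * F r)).
    by apply: ler_sum => j _; rewrite divfK ?gt_eqF// gerBl ltW.
  rewrite -mulr_suml mulrA ler_wpM2r ?(ltW Fr)//.
  have h : (\sum_(1 <= j < J.+1) u j) ^+ 2 <= 4 * (2 * C * n%:R) * J%:R.
    apply: sum_le_of_sqr => //; first by rewrite !mulr_ge0 ?ltW.
    move=> j /andP[j1 jJ]; rewrite /u expr_div_n mulrAC ler_pdivrMr ?exprn_gt0//.
    have jR : (0 : R) < j%:R by rewrite ltr0n.
    have jn : (j%:R : R) <= n%:R by rewrite ler_nat ltnW// (leq_ltn_trans jJ).
    have xpos : 0 < j%:R * r / (2 * n%:R) by rewrite divr_gt0 ?mulr_gt0.
    have xr : j%:R * r / (2 * n%:R) <= r.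
      rewrite ler_pdivrMr ?mulr_gt0// mulrC ler_wpM2l ?ltW//; lra.
    have := hC _ _ xpos xr rx0; set y := F _ ^+ 2.
    rewrite mulrAC ler_pdivrMr ?mulr_gt0// => hy.
    rewrite -(ler_pM2l r0); lra.
  have S0 : 0 <= \sum_(1 <= j < J.+1) u j by apply: sumr_ge0.
  suff : (\sum_(1 <= j < J.+1) u j) ^+ 2 <= (eps / 2 * n%:R) ^+ 2.
    have x0' : 0 <= eps / 2 * n%:R by rewrite mulr_ge0// ltW// divr_gt0.
    by rewrite ler_pXn2r.
  apply: le_trans h _.
  have : (8 * C * n%:R) * J%:R <= (8 * C * n%:R) * (kap * n%:R).
    by rewrite ler_wpM2l// !mulr_ge0// ltW.
  have : 32 * C * kap * (n%:R * n%:R) <= eps ^+ 2 * (n%:R * n%:R).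
    by rewrite ler_wpM2r// mulr_ge0 ltW.
  rewrite exprMn expr_div_n [n%:R ^+ 2]expr2; lra.
have part2 : \sum_(J.+1 <= j < n) (F (j%:R * r / (2 * n%:R)) - F (2 * r)) <= eps / 2 * (n%:R * F r).
  apply: (@le_trans _ _ (\sum_(J.+1 <= j < n) (eps / 2 * F r))).
    rewrite big_nat_cond [leRHS]big_nat_cond; apply: ler_sum => j /andP[/andP[Jj jn] _].
    have a1 : F (j%:R * r / (2 * n%:R)) <= F (kap / 2 * r).
      apply: F_mono; rewrite ler_pdivlMr ?mulr_gt0//.
      have : kap * n%:R * r <= j%:R * r.
        by rewrite ler_wpM2r ?(ltW r0)// (le_trans (ltW Jgt))// ler_nat.
      lra.
    have := h1 r rr1; rewrite ler_norml => /andP[_ a2].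
    have := h2 r rr2; rewrite ler_norml => /andP[a3 _].
    lra.
  rewrite sumr_const_nat -[_ *+ _]mulr_natl mulrCA ler_pM2l ?divr_gt0//.
  by rewrite ler_wpM2r ?(ltW Fr)// ler_nat leq_subr.
lra.
Qed.

(** F may have atoms, so n F(s) cannot be prescribed exactly; but along the
    powers of 2 consecutive values of F eventually differ by a factor at most
    2. *)
Lemma exists_quantile c r0 : 0 < c -> exists N : nat, forall n, (N <= n)%N ->
  exists2 s, r0 <= s & c <= n%:R * F s <= 2 * c.
Proof.
move=> c0; have half0 : (0 : R) < 2^-1 by rewrite invr_gt0.
have two0 : (0 : R) < 2 by [].
have [r1 r10 h1] := sv_close two0 half0.
have expn2 (x : R) : exists k : nat, x <= 2 ^+ k.
  exists (archimedean.Num.bound `|x|); apply: (@le_trans _ _ `|x|); first exact: ler_norm.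
  apply: ltW; apply: lt_le_trans (archimedean.Num.Theory.archi_boundP (normr_ge0 x)) _.
  by rewrite -natrX ler_nat ltnW// ltn_expl.
have [K hK] := expn2 (Num.max r0 r1).
have [N hN] : exists N : nat, c / F (2 ^+ K) <= N%:R.
  exists (archimedean.Num.bound (c / F (2 ^+ K))); apply: ltW.
  by apply: archimedean.Num.Theory.archi_boundP; rewrite divr_ge0// ltW.
exists N => n Nn.
have cn k : (k <= K)%N -> c <= n%:R * F (2 ^+ k).
  move=> kK; apply: (@le_trans _ _ (N%:R * F (2 ^+ K))); first by rewrite -ler_pdivrMr.
  apply: ler_pM => //; rewrite ?ler_nat//; first exact: ltW.
  by apply: F_mono; rewrite ler_eXn2l ?ltr1n.
have ex : exists k : nat, n%:R * F (2 ^+ k) < c.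
  have n1 : (0 : R) < n.+1%:R by [].
  have [t ht] := F_vanish (divr_gt0 c0 n1).
  have [k hk] := expn2 t; exists k.
  apply: (@le_lt_trans _ _ (n.+1%:R * F t)); last by rewrite mulrC -ltr_pdivlMr.
  by apply: ler_pM => //; rewrite ?ler_nat// ?F_mono// ltW.
case: (ex_minnP ex) => [[|m]] hm mmin.
  by have := cn 0%N (leq0n _); rewrite leNgt hm.
have Km : (K <= m)%N.
  by rewrite leqNgt; apply/negP => mK; have := cn m.+1 mK; rewrite leNgt hm.
have big : Num.max r0 r1 <= 2 ^+ m.
  by apply: le_trans hK _; rewrite ler_eXn2l ?ltr1n.
move: big; rewrite ge_max => /andP[big0 big1].
exists (2 ^+ m) => //; apply/andP; split.
  by rewrite leNgt; apply/negP => /mmin; rewrite ltnn.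
have := h1 _ big1; rewrite -exprS ler_norml => /andP[h _].
have : n%:R * F (2 ^+ m) <= n%:R * (2 * F (2 ^+ m.+1)) by rewrite ler_wpM2l//; lra.
lra.
Qed.

(** [potter_bound] gives F(s) >= const s^(-1/p), hence n F(s) <= c forces
    s >= const n^p. *)
Lemma quantile_growth (c : R) p : 0 < c -> exists2 b, 0 < b & exists r0, forall s n,
  r0 <= s -> n%:R * F s <= c -> b * n%:R ^+ p <= s.
Proof.
move=> c0; have [C C0 [x0 x00 hC]] := potter_bound p.
exists (x0 * F x0 ^+ p / (C * c ^+ p)).
  by rewrite divr_gt0 ?mulr_gt0 ?exprn_gt0.
exists x0 => s n x0s hs.
have h := hC x0 s x00 x0s x0s.
have s0 : 0 < s by exact: lt_le_trans x0s.
have h1 : n%:R ^+ p * F s ^+ p <= c ^+ p.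
  have ns0 : 0 <= n%:R * F s by rewrite mulr_ge0// ltW.
  by rewrite -exprMn lerXn2r// nnegrE ltW.
rewrite mulrAC ler_pdivrMr ?mulr_gt0 ?exprn_gt0//.
apply: (@le_trans _ _ (C * (s * F s ^+ p) * n%:R ^+ p)).
  by rewrite ler_wpM2r// exprn_ge0.
have : C * s * (n%:R ^+ p * F s ^+ p) <= C * s * c ^+ p.
  by rewrite ler_wpM2l// mulr_ge0// ltW.
lra.
Qed.

End SlowlyVaryingTail.

Section SymmetrizedKaramata.
Context (R : realType) (F : R -> R).
Hypothesis F_mono : forall x y, x <= y -> F y <= F x.

(** The function of min(j, n - j) is at most the sum of those of j and of n - j,
    and j -> n - j preserves the range. *)
Lemma sum_min_karamata_le (eps r : R) n : 0 < r -> (0 < n)%N ->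
  \sum_(1 <= j < n) (F (j%:R * r / (2 * n%:R)) - F (2 * r)) <= eps ->
  \sum_(1 <= j < n) (F ((minn j (n - j))%:R * r / (2 * n%:R)) - F (2 * r)) <= 2 * eps.
Proof.
move=> r0 n0 h; have nR : (0 : R) < n%:R by rewrite ltr0n.
pose f j := F (j%:R * r / (2 * n%:R)) - F (2 * r).
have f0 j : (j <= n)%N -> 0 <= f j.
  move=> jn; rewrite subr_ge0 F_mono// ler_pdivrMr ?mulr_gt0//.
  have : (j%:R : R) * r <= n%:R * r by rewrite ler_wpM2r ?ler_nat// ltW.
  have : 0 < n%:R * r by rewrite mulr_gt0.
  lra.
have rev : \sum_(1 <= j < n) f (n - j)%N = \sum_(1 <= j < n) f j.
  rewrite [RHS]big_nat_rev/=; apply: eq_big_nat => j _.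
  by rewrite add1n subSS.
apply: (@le_trans _ _ (\sum_(1 <= j < n) (f j + f (n - j)%N))).
  rewrite big_nat_cond [leRHS]big_nat_cond; apply: ler_sum => j /andP[/andP[j1 jn] _].
  have fj := f0 j (ltnW jn); have fnj := f0 (n - j)%N (leq_subr _ _).
  by case: leqP => _; [rewrite -/(f j)|rewrite -/(f (n - j)%N)]; lra.
rewrite big_split/= rev; have : \sum_(1 <= j < n) f j <= eps by exact: h.
lra.
Qed.

End SymmetrizedKaramata.

(** * Probability of the bad events *)

Section FiniteUnionBounds.
Context d (T : measurableType d) (R : realType) (P : probability T R).

Definition pr (E : set T) : R := fine (P E).

Lemma prE E : measurable E -> P E = (pr E)%:E.
Proof. by move=> mE; rewrite fineK// fin_num_measure. Qed.

Lemma pr_cover n (A : set T) (F : nat -> set T) : measurable A ->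
  (forall k, (k < n)%N -> measurable (F k)) ->
  (forall w, A w -> exists2 k, (k < n)%N & F k w) ->
  pr A <= \sum_(0 <= k < n) pr (F k).
Proof.
move=> mA mF cov; rewrite -lee_fin -prE// big_mkord -sumEFin.
have -> : (\sum_(k < n) (pr (F k))%:E = \sum_(k < n) P (F k))%E.
  by apply: eq_bigr => k _; rewrite prE//; exact: mF.
apply: content_subadditive => // w /cov[k kn Fk].
by rewrite -bigcup_mkord; exists k.
Qed.

Lemma pr_cover2 (A B C : set T) : measurable A -> measurable B -> measurable C ->
  (forall w, A w -> B w \/ C w) -> pr A <= pr B + pr C.
Proof.
move=> mA mB mC cov.
have := @pr_cover 2 A (fun k => if k == 0%N then B else C) mA.
rewrite big_nat_recr//= big_nat1/=; apply; first by move=> [|k] _.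
by move=> w /cov[h|h]; [exists 0%N|exists 1%N].
Qed.

Lemma pr_setC E : measurable E -> pr (~` E) = 1 - pr E.
Proof. by move=> mE; rewrite /pr probability_setC// (prE mE). Qed.

Lemma pr_le1 E : measurable E -> pr E <= 1.
Proof. by move=> mE; rewrite -lee_fin -prE// probability_le1. Qed.

Lemma pr_mono A B : measurable A -> measurable B -> A `<=` B -> pr A <= pr B.
Proof.
by move=> mA mB AB; rewrite -lee_fin -!prE//; apply: le_measure; rewrite ?inE.
Qed.

End FiniteUnionBounds.

Section ModulusEvents.
Context d (T : measurableType d) (R : realType) (P : probability T R).
Context (X : nat -> T -> R[i]).
Hypothesis X_iid : complex_iid P X.
Hypothesis X_neq0 : {ae P, forall w, X 0%N w != 0}.
Local Notation pr := (pr P).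

(** Events on moduli only: |z| is a measurable function of the pair of real and
    imaginary parts, so independence and equality of laws carry over. *)
Definition modulus_in k (I : set (measurableTypeR R)) : set T :=
  [set w | I (normc (X k w))].

Let mX k : measurable_fun setT (fun w => reim (X k w)).
Proof. by case: X_iid => + _ _; apply. Qed.

Let N (p : measurableTypeR R * measurableTypeR R) : measurableTypeR R :=
  Num.sqrt (p.1 ^+ 2 + p.2 ^+ 2).

Let mN : measurable_fun setT N.
Proof.
rewrite (_ : N = (@Num.sqrt R : measurableTypeR R -> measurableTypeR R) \o
   (fun p => p.1 ^+ 2 + p.2 ^+ 2))//.
apply: measurableT_comp; first exact: continuous_measurable_fun (@sqrt_continuous R).
by apply: measurable_funD; apply: measurable_funX; [exact: measurable_fst|exact: measurable_snd].
Qed.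

Let mNI I : measurable I -> measurable (N @^-1` I).
Proof. by move=> mI; rewrite -[X in measurable X]setTI; apply: mN. Qed.

Lemma modulus_inE k I : modulus_in k I = (fun w => reim (X k w)) @^-1` (N @^-1` I).
Proof. by apply/seteqP; split => w; rewrite /modulus_in/N/=; case: (X k w). Qed.

Lemma measurable_modulus_in k I : measurable I -> measurable (modulus_in k I).
Proof.
by move=> mI; rewrite modulus_inE -[X in measurable X]setTI; apply: mX => //; exact: mNI.
Qed.

Lemma pr_modulus_in k I : measurable I -> pr (modulus_in k I) = pr (modulus_in 0 I).
Proof.
move=> mI; case: X_iid => _ _ /(_ k _ (mNI mI)).
by rewrite /pr !modulus_inE => ->.
Qed.

Lemma pr_modulus_in_seq (s : seq nat) (I : nat -> set (measurableTypeR R)) : uniq s ->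
  (forall k, measurable (I k)) ->
  pr (\bigcap_(k in [set` s]) modulus_in k (I k)) = \prod_(k <- s) pr (modulus_in 0 (I k)).
Proof.
move=> us mI; case: X_iid => _ /(_ [fset x in s]%fset (fun k => N @^-1` I k) (fun k => mNI (mI k))) + _.
have -> : [set` [fset x in s]%fset] = [set` s].
  by apply/seteqP; split => k /=; rewrite inE.
have -> : \bigcap_(k in [set` s]) (fun w => reim (X k w)) @^-1` (N @^-1` I k) =
    \bigcap_(k in [set` s]) modulus_in k (I k).
  by apply: eq_bigcapr => k _; rewrite modulus_inE.
move=> h; rewrite /pr h.
have -> : (\prod_(k <- [fset x in s]%fset) P ((fun w => reim (X k w)) @^-1` (N @^-1` I k)) =
    \prod_(k <- s) (pr (modulus_in 0 (I k)))%:E)%E.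
  rewrite (perm_big s)/=; last first.
    by apply: uniq_perm => [|//|k]; [exact: fset_uniq|rewrite inE].
  apply: eq_bigr => k _; rewrite -modulus_inE (prE P)//; last exact: measurable_modulus_in.
  by rewrite pr_modulus_in.
by rewrite prodEFin.
Qed.

Lemma pr_modulus_in2 i j I J : i != j -> measurable I -> measurable J ->
  pr (modulus_in i I `&` modulus_in j J) = pr (modulus_in 0 I) * pr (modulus_in 0 J).
Proof.
move=> ij mI mJ; have := @pr_modulus_in_seq [:: i; j] (fun k => if k == i then I else J).
rewrite /= inE ij => /(_ isT) h.
rewrite !big_cons big_nil mulr1 eqxx eq_sym (negbTE ij) in h.
rewrite -h; last by move=> k; case: ifP.
congr pr; apply/seteqP; split => w.
  move=> [h1 h2] k /=; rewrite !inE => /orP[] /eqP ->; rewrite ?eqxx//.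
  by rewrite eq_sym (negbTE ij).
move=> h'; have /= h1 := h' i; have /= h2 := h' j.
rewrite eqxx eq_sym (negbTE ij) !inE !eqxx orbT /= in h1 h2; split; [exact: h1|exact: h2].
Qed.

Lemma pr_modulus_in_all n I : measurable I ->
  pr (\bigcap_(k < n) modulus_in k I) = pr (modulus_in 0 I) ^+ n.
Proof.
move=> mI; have := @pr_modulus_in_seq (iota 0 n) (fun=> I) (iota_uniq _ _) (fun=> mI).
rewrite big_const_seq count_predT size_iota iter_mulr_1 => <-.
by rewrite (_ : `I_n = [set` iota 0 n])//; apply/seteqP; split => k /=; rewrite mem_iota.
Qed.

Lemma measurable_log_gt t : measurable ([set r | t < ln r] : set (measurableTypeR R)).
Proof.
rewrite (_ : [set r | _] = (@ln R : measurableTypeR R -> measurableTypeR R) @^-1` [set` `]t, +oo[%R]).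
  by rewrite -[X in measurable X]setTI; apply: (@measurable_ln R) => //; exact: measurable_itv.
by apply/seteqP; split => r /=; rewrite in_itv/= andbT.
Qed.

Lemma measurable_log_itv u v :
  measurable ([set r | u < ln r <= v] : set (measurableTypeR R)).
Proof.
rewrite (_ : [set r | _] = (@ln R : measurableTypeR R -> measurableTypeR R) @^-1` [set` `]u, v]%R]).
  by rewrite -[X in measurable X]setTI; apply: (@measurable_ln R) => //; exact: measurable_itv.
by apply/seteqP; split => r /=; rewrite in_itv.
Qed.

Local Notation F := (log_tail P (X 0%N)).

Lemma log_tailE t : F t = pr (modulus_in 0 [set r | t < ln r]).
Proof. by []. Qed.

Lemma log_tail_mono x y : x <= y -> F y <= F x.
Proof.
move=> xy; rewrite !log_tailE; apply: pr_mono.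
- by apply: measurable_modulus_in; exact: measurable_log_gt.
- by apply: measurable_modulus_in; exact: measurable_log_gt.
by move=> w /=; exact: le_lt_trans.
Qed.

Lemma pr_log_itv u v : u <= v -> pr (modulus_in 0 [set r | u < ln r <= v]) = F u - F v.
Proof.
move=> uv; have m1 := measurable_modulus_in 0 (measurable_log_itv u v).
have m2 := measurable_modulus_in 0 (measurable_log_gt v).
have m3 := measurable_modulus_in 0 (measurable_log_gt u).
apply/eqP; rewrite eq_sym subr_eq; apply/eqP.
rewrite !log_tailE /pr -fineD ?fin_num_measure// -measureU//.
  congr (fine (P _)); apply/seteqP; split => w /=.
    move=> h; have [hv|hv] := leP (ln (normc (X 0%N w))) v; last by right.
    by left; apply/andP.
  by rewrite /modulus_in/=; case => [/andP[]//|]; exact: le_lt_trans.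
apply/seteqP; split => // w [/andP[_ h]]; rewrite /modulus_in/=.
by move/(le_lt_trans h); rewrite ltxx.
Qed.

(** The value r = 0 is listed apart because of the convention ln 0 = 0. *)
Definition log_outside (K : R) : set (measurableTypeR R) :=
  [set r | r = 0 \/ K < `|ln r| ].

Lemma measurable_log_outside K : measurable (log_outside K).
Proof.
rewrite (_ : log_outside K = [set 0] `|` (fun r : measurableTypeR R => `|ln r|) @^-1` [set` `]K, +oo[%R]).
  apply: measurableU; first exact: measurable_set1.
  rewrite -[X in measurable X]setTI.
  have mf : measurable_fun setT (fun r : measurableTypeR R => `|ln r| : measurableTypeR R).
    exact: measurableT_comp (@normr_measurable R setT) (@measurable_ln R).
  by apply: mf => //; exact: measurable_itv.
by apply/seteqP; split => r /=; rewrite in_itv/= andbT.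
Qed.

(** The events decrease to {X 0 = 0}, which is negligible. *)
Lemma log_outside_vanish eta : 0 < eta ->
  exists2 K, 0 <= K & pr (modulus_in 0 (log_outside K)) < eta.
Proof.
move=> eta0; pose C (k : nat) := modulus_in 0 (log_outside k%:R).
have mC k : measurable (C k) by apply: measurable_modulus_in; exact: measurable_log_outside.
have capE : \bigcap_k C k = ~` [set w | X 0%N w != 0].
  apply/seteqP; split => w /=.
    move=> h; apply/negP; rewrite negbK.
    have [/eqP|/=] := h (archimedean.Num.bound `|ln (normc (X 0%N w))|) I.
      by rewrite normc_eq0.
    by rewrite ltNge ltW// archimedean.Num.Theory.archi_boundP.
  by move=> /negP; rewrite negbK => /eqP h k _; left; rewrite h normc0.
have cap0 : P (\bigcap_k C k) = 0%E.
  apply/negligibleP; first exact: bigcapT_measurable.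
  by rewrite capE.
have cv : (P \o C) x @[x --> \oo] --> 0%E.
  rewrite -cap0; apply: nonincreasing_cvg_mu => //.
  - by rewrite (le_lt_trans (probability_le1 _ _))// ltry.
  - exact: bigcapT_measurable.
  move=> n m nm; apply/subsetPset => w [|h]; [by left|right].
  by apply: le_lt_trans h; rewrite ler_nat.
have /fine_cvgP[_ /cvgrPdist_lt/(_ eta eta0)[k _ hk]] := cv.
exists k%:R => //; have := hk k (leqnn k).
by rewrite /= sub0r normrN ger0_norm// fine_ge0.
Qed.

Lemma log_tail_vanish eta : 0 < eta -> exists t, F t < eta.
Proof.
move=> /log_outside_vanish[K K0 hK]; exists K; apply: le_lt_trans hK.
rewrite log_tailE; apply: pr_mono.
- by apply: measurable_modulus_in; exact: measurable_log_gt.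
- by apply: measurable_modulus_in; exact: measurable_log_outside.
by move=> w /= h; right; apply: lt_le_trans h _; exact: ler_norm.
Qed.

End ModulusEvents.

(** An elementary substitute for (1 - x)^n <= exp(- n x). *)
Lemma expr_1B_le (R : realFieldType) n (x : R) : 0 <= x <= 1 ->
  (1 - x) ^+ n * (1 + n%:R * x) <= 1.
Proof.
move=> /andP[x0 x1]; elim: n => [|n IH]; first by rewrite expr0 mul0r addr0 mul1r.
apply: le_trans IH; rewrite exprSr -mulrA ler_wpM2l//.
  by rewrite exprn_ge0// subr_ge0.
rewrite -natr1; have : 0 <= n%:R * (x * x) by rewrite !mulr_ge0.
have : 0 <= x * x by rewrite mulr_ge0.
lra.
Qed.

Section BadEvents.
Context d (T : measurableType d) (R : realType) (P : probability T R).
Context (X : nat -> T -> R[i]).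
Hypothesis X_iid : complex_iid P X.
Hypothesis X_tail : slowly_varying (log_tail P (X 0%N)).
Local Notation pr := (pr P).
Local Notation F := (log_tail P (X 0%N)).
Local Notation L k w := (ln (normc (X k w))).
Local Notation gt t := ([set r | t < ln r]).
Local Notation itv u v := ([set r | u < ln r <= v]).

Let mgt k t : measurable (modulus_in X k (gt t)).
Proof. by apply: (measurable_modulus_in X_iid); exact: measurable_log_gt. Qed.

Let mitv k u v : measurable (modulus_in X k (itv u v)).
Proof. by apply: (measurable_modulus_in X_iid); exact: measurable_log_itv. Qed.

Let F_mono x y : x <= y -> F y <= F x := log_tail_mono X_iid (x:=x) (y:=y).

Let F_le1 t : F t <= 1.
Proof. by rewrite log_tailE; exact: pr_le1. Qed.

Lemma log_tail_gt0 t : 0 < F t.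
Proof.
case: X_tail => -[M [_ hM]] _; apply: lt_le_trans (hM (Num.max t (M + 1)) _) _.
  by rewrite lt_max ltrDl ltr01 orbT.
by apply: F_mono; rewrite le_max lexx.
Qed.

Lemma pr_none_exceeds n s :
  pr (\bigcap_(k < n) modulus_in X k (~` gt s)) <= (1 + n%:R * F s)^-1.
Proof.
rewrite (pr_modulus_in_all X_iid); last by apply: measurableC; exact: measurable_log_gt.
have -> : pr (modulus_in X 0 (~` gt s)) = 1 - F s by rewrite log_tailE -pr_setC.
rewrite -[leRHS]mul1r ler_pdivlMr; last by rewrite ltr_pwDl// mulr_ge0// ltW// log_tail_gt0.
by apply: expr_1B_le; rewrite F_le1 andbT ltW// log_tail_gt0.
Qed.

(** Covers the event that s < L i and rho * L i < L j <= L i. On each dyadic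
    level of L i the constraints on i and j decouple, so that the probabilities
    factor; the first term collects the levels above M. *)
Definition dyadic_competitor (rho s : R) M i j : set T :=
  modulus_in X i (gt (2 ^+ M * s)) `|`
  \bigcup_(m < M) (modulus_in X i (itv (2 ^+ m * s) (2 ^+ m.+1 * s)) `&`
                   modulus_in X j (itv (rho * (2 ^+ m * s)) (2 ^+ m.+1 * s))).

Lemma measurable_dyadic_competitor rho s M i j :
  measurable (dyadic_competitor rho s M i j).
Proof.
apply: measurableU => //; apply: bigcup_measurable => m _.
exact: measurableI.
Qed.

Lemma dyadic_competitorP rho s M i j w : 0 <= rho -> s < L i w -> L j w <= L i w ->
  rho * L i w < L j w -> dyadic_competitor rho s M i j w.
Proof.
move=> rho0 si ji ij; have [big|small] := ltP (2 ^+ M * s) (L i w); first by left.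
right; elim: M small => [|M IH] small.
  by move: small; rewrite expr0 mul1r leNgt si.
have [le|lt] := leP (L i w) (2 ^+ M * s).
  by have [m /= mM h] := IH le; exists m => //=; rewrite ltnS ltnW.
exists M => //=; split; rewrite /modulus_in/=; first by rewrite lt small.
rewrite (le_trans ji)// andbT; apply: le_lt_trans ij.
by rewrite ler_wpM2l// ltW.
Qed.

Lemma pr_dyadic_competitor rho s M i j : i != j -> 0 < s -> rho <= 2 ->
  pr (dyadic_competitor rho s M i j) <= F (2 ^+ M * s) +
   \sum_(0 <= m < M) (F (2 ^+ m * s) - F (2 ^+ m.+1 * s)) *
                    (F (rho * (2 ^+ m * s)) - F (2 * (2 ^+ m * s))).
Proof.
move=> ij s0 rho2.
set U := \bigcup_(m < M) (modulus_in X i (itv (2 ^+ m * s) (2 ^+ m.+1 * s)) `&`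
                   modulus_in X j (itv (rho * (2 ^+ m * s)) (2 ^+ m.+1 * s))).
have mU : measurable U by apply: bigcup_measurable => m _; exact: measurableI.
apply: (@le_trans _ _ (pr (modulus_in X i (gt (2 ^+ M * s))) + pr U)).
  apply: pr_cover2 => //; exact: measurable_dyadic_competitor.
apply: lerD; first by rewrite (pr_modulus_in X_iid)//; exact: measurable_log_gt.
apply: (@le_trans _ _ (\sum_(0 <= m < M) pr
    (modulus_in X i (itv (2 ^+ m * s) (2 ^+ m.+1 * s)) `&`
     modulus_in X j (itv (rho * (2 ^+ m * s)) (2 ^+ m.+1 * s))))).
  apply: pr_cover; [exact: mU|by move=> k _; exact: measurableI|].
  by move=> w [m mM h]; exists m.
apply: ler_sum => m _.
rewrite (pr_modulus_in2 X_iid ij); try exact: measurable_log_itv.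
have rm0 : 0 < 2 ^+ m * s by rewrite mulr_gt0// exprn_gt0.
have -> : 2 ^+ m.+1 * s = 2 * (2 ^+ m * s) by rewrite exprS mulrA.
by rewrite !(pr_log_itv X_iid)//; [rewrite ler_pM2r|lra].
Qed.

(** For each i and each level r_m, Karamata's theorem bounds the sum over j by
    2 eps n F(r_m) <= 2 eps n F(s), and the probabilities of the levels telescope
    to at most F(s). *)
Lemma sum_pr_dyadic_competitor (eps s : R) n M : (0 < n)%N -> 0 < s -> 0 <= eps ->
  (forall r, s <= r ->
    \sum_(1 <= j < n) (F (j%:R * r / (2 * n%:R)) - F (2 * r)) <= eps * (n%:R * F r)) ->
  \sum_(0 <= i < n.+1) \sum_(1 <= j < n | i != j)
     pr (dyadic_competitor ((minn j (n - j))%:R / (2 * n%:R)) s M i j)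
  <= 2 * n%:R ^+ 2 * F (2 ^+ M * s) + 4 * eps * (n%:R * F s) ^+ 2.
Proof.
move=> n0 s0 eps0 hkar.
have nR : (0 : R) < n%:R by rewrite ltr0n.
pose rho j : R := (minn j (n - j))%:R / (2 * n%:R).
have rho2 j : (j < n)%N -> rho j <= 2.
  move=> jn; rewrite /rho ler_pdivrMr ?mulr_gt0//.
  have : ((minn j (n - j))%:R : R) <= n%:R by rewrite ler_nat geq_min ltnW.
  lra.
pose r m : R := 2 ^+ m * s.
have sr m : s <= r m by rewrite /r ler_peMl ?(ltW s0)// exprn_ege1// ler1n.
have r0 m : 0 < r m by exact: lt_le_trans (sr m).
have rS m : r m.+1 = 2 * r m by rewrite /r exprS mulrA.
have Fs := log_tail_gt0 s.
pose b : R := n%:R * F (r M) + 2 * eps * n%:R * F s * F s.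
have inner i : \sum_(1 <= j < n | i != j) pr (dyadic_competitor (rho j) s M i j) <= b.
  pose g j := F (r M) + \sum_(0 <= m < M) (F (r m) - F (r m.+1)) * (F (rho j * r m) - F (2 * r m)).
  have dF m : 0 <= F (r m) - F (r m.+1).
    by rewrite subr_ge0 F_mono// rS ler_peMl ?(ltW (r0 m))// ler1n.
  have g0 j : (j < n)%N -> 0 <= g j.
    move=> jn; rewrite addr_ge0 ?(ltW (log_tail_gt0 _))// sumr_ge0// => m _.
    by rewrite mulr_ge0// subr_ge0 F_mono// ler_wpM2r ?rho2// ltW.
  apply: (@le_trans _ _ (\sum_(1 <= j < n) g j)).
    rewrite big_mkcond/= big_nat_cond [leRHS]big_nat_cond.
    apply: ler_sum => j /andP[/andP[j1 jn] _]; case: ifPn => ij; last exact: g0.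
    by apply: pr_dyadic_competitor => //; exact: rho2.
  rewrite big_split/= lerD//.
    rewrite sumr_const_nat -[_ *+ _]mulr_natl ler_wpM2r ?(ltW (log_tail_gt0 _))//.
    by rewrite ler_nat leq_subr.
  rewrite exchange_big/=.
  apply: (@le_trans _ _ (\sum_(0 <= m < M) (F (r m) - F (r m.+1)) * (2 * eps * n%:R * F s))).
    apply: ler_sum => m _; rewrite -mulr_sumr ler_wpM2l//.
    have h := sum_min_karamata_le F_mono (r0 m) n0 (hkar (r m) (sr m)).
    rewrite (eq_bigr (fun j => F ((minn j (n - j))%:R * r m / (2 * n%:R)) - F (2 * r m))); last first.
      by move=> j _; rewrite /rho mulrAC.
    apply: le_trans h _; rewrite -!mulrA ler_wpM2l// ler_wpM2l//.
    by rewrite ler_wpM2l ?(ltW nR)//; exact: F_mono.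
  rewrite -mulr_suml mulrC ler_wpM2l ?mulr_ge0 ?(ltW nR) ?(ltW Fs)//.
  under eq_bigr do rewrite -opprB.
  rewrite sumrN telescope_sumr// opprB lerBlDr /r expr0 mul1r lerDl.
  exact: ltW (log_tail_gt0 _).
apply: (@le_trans _ _ (\sum_(0 <= i < n.+1) b)); first by apply: ler_sum => i _; exact: inner.
rewrite sumr_const_nat subn0 -[_ *+ _]mulr_natl -natr1.
have b0 : 0 <= b.
  by rewrite addr_ge0 ?mulr_ge0 ?(ltW nR) ?(ltW Fs) ?(ltW (log_tail_gt0 _)).
have n1 : (1 : R) <= n%:R by rewrite ler1n.
apply: (@le_trans _ _ ((n%:R + n%:R) * b)); first by rewrite ler_wpM2r// lerD2l.
by rewrite /b le_eqVlt; apply/orP; left; apply/eqP; rewrite /r; ring.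
Qed.

End BadEvents.

(** * The good event has probability close to one *)

Section Assembly.
Context d (T : measurableType d) (R : realType) (P : probability T R).
Context (X : nat -> T -> R[i]).
Hypothesis X_iid : complex_iid P X.
Hypothesis X_neq0 : {ae P, forall w, X 0%N w != 0}.
Hypothesis X_tail : slowly_varying (log_tail P (X 0%N)).
Context (tau : nat -> T -> nat).
Hypothesis tau_max : forall n w, is_max_index (fun k => X k w) n (tau n w).
Local Notation pr := (pr P).
Local Notation F := (log_tail P (X 0%N)).
Local Notation L k w := (ln (normc (X k w))).

Definition good_event A n : set T :=
  [set w | [/\ unique_max (fun k => X k w) n (tau n w),
               roots_close A (fun k => X k w) n (tau n w) &
               roots_separated A (fun k => X k w) n (tau n w)]].

(** If a_0, a_n are bounded, some a_k exceeds s, and no j competes with the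
    maximal index t, then the tent condition of [dominant_coefficient_roots] holds.
    This also forces 0 < t < n, since a_t > s > K. *)
Lemma not_good_cover A (K D s : R) M n w :
  0 <= K -> 0 < D -> 4 * n%:R ^+ 2 <= expR D -> n%:R `^ A <= D -> (0 < n)%N ->
  0 < s -> 2 * n%:R * (2 * K + 2 * D) <= s ->
  ~ good_event A n w ->
  [\/ modulus_in X 0 (log_outside K) w, modulus_in X n (log_outside K) w,
      (\bigcap_(k < n.+1) modulus_in X k (~` [set r | s < ln r])) w |
      exists2 i, (i < n.+1)%N & exists2 j, (1 <= j < n)%N && (i != j) &
        dyadic_competitor X ((minn j (n - j))%:R / (2 * n%:R)) s M i j w].
Proof.
move=> K0 D0 nD AD n0 s0 Ds ng.
have inside k : ~ modulus_in X k (log_outside K) w -> X k w != 0 /\ - K <= L k w <= K.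
  move=> no; split.
    by apply/eqP => h; apply: no; left; rewrite h normc0.
  by rewrite -ler_norml leNgt; apply/negP => h; apply: no; right.
have [|/inside[X0 L0]] := pselect (modulus_in X 0 (log_outside K) w); first by constructor 1.
have [|/inside[Xn Ln]] := pselect (modulus_in X n (log_outside K) w); first by constructor 2.
set E := \bigcap_(k < n.+1) _.
have [|notE] := pselect (E w); first by constructor 3.
set E4 := exists2 i, _ & _.
have [|no4] := pselect E4; first by constructor 4.
exfalso; apply: ng; have [tn tmax] := tau_max n w; set t := tau n w in tn tmax *.
have nR : (0 : R) < n%:R by rewrite ltr0n.
have st : s < L t w.
  rewrite ltNge; apply/negP => ts; apply: notE => k /= kn; rewrite /modulus_in/=.
  apply/negP; rewrite -leNgt.
  have [k0|k0] := eqVneq (X k w) 0; first by rewrite k0 normc0 ln0// ltW.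
  apply: le_trans ts; have kt := tmax k kn.
  by rewrite ler_ln ?posrE ?normc_gt0// -normc_gt0 (lt_le_trans _ kt)// normc_gt0.
have n1 : (1 : R) <= n%:R by rewrite ler1n.
have Ks : K < s.
  apply: lt_le_trans Ds; have : 0 <= (n%:R - 1) * (2 * K + 2 * D).
    by rewrite mulr_ge0 ?subr_ge0// addr_ge0 ?mulr_ge0// ltW.
  lra.
have /andP[_ L0K] := L0; have /andP[_ LnK] := Ln.
have t0 : (0 < t)%N.
  by rewrite lt0n; apply/eqP => t0; move: st; rewrite t0; lra.
have tln : (t < n)%N.
  by rewrite ltn_neqAle tn andbT; apply/eqP => tE; move: st; rewrite tE; lra.
apply: (@dominant_coefficient_roots R _ n t K D A) => //; first by rewrite t0.
  exact: le_trans Ds (ltW st).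
move=> j /andP[j0 jn] jt xj; rewrite leNgt; apply/negP => hj; apply: no4.
exists t; first by rewrite ltnS.
exists j; first by rewrite j0 jn eq_sym.
apply: dyadic_competitorP => //.
- have jt' := tmax j (ltnW jn).
  by rewrite ler_ln ?posrE ?normc_gt0// -normc_gt0 (lt_le_trans _ jt')// normc_gt0.
- by rewrite mulrAC ltr_pdivrMr// mulr_gt0.
Qed.

(** The bounds are collected with c = 1/eta and eps = eta/(16 c^2), which makes
    the second term of [sum_pr_dyadic_competitor] at most eta; n is then taken
    large, and M is chosen last, depending on n. *)
Lemma pr_good_event_ge A (eta : R) : 0 < eta ->
  exists N, forall n, (N <= n)%N -> 1 - pr (good_event A n) <= 5 * eta.
Proof.
move=> eta0.
have mono x y : x <= y -> F y <= F x by exact: log_tail_mono X_iid _ _.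
have pos t : 0 < F t by exact: log_tail_gt0 X_iid X_tail t.
have le1 t : F t <= 1.
  rewrite log_tailE; apply: pr_le1; apply: (measurable_modulus_in X_iid).
  exact: measurable_log_gt.
have vanish := log_tail_vanish X_iid X_neq0.
have sv : forall lam, 0 < lam -> F (lam * t) / F t @[t --> +oo] --> (1 : R) by case: X_tail.
(* With an exponent at least 3 and n >= 4 one has 4 n^2 <= n^m <= exp(n^m). *)
pose m := maxn 3 (archimedean.Num.bound `|A|).
have m3 : (3 <= m)%N by rewrite leq_maxl.
have Am : A <= m%:R.
  apply: (@le_trans _ _ `|A|); first exact: ler_norm.
  apply: (@le_trans _ _ (archimedean.Num.bound `|A|)%:R).
    by apply: ltW; exact: archimedean.Num.Theory.archi_boundP.
  by rewrite ler_nat leq_maxr.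
have [K K0 hK] := log_outside_vanish X_iid X_neq0 eta0.
pose c := eta^-1; have c0 : 0 < c by rewrite invr_gt0.
pose eps := eta / (16 * c ^+ 2).
have eps0 : 0 < eps by rewrite divr_gt0// mulr_gt0// exprn_gt0.
have [r0 r00 hkar] := karamata_sum mono pos le1 sv eps0.
have c20 : 0 < 2 * c by rewrite mulr_gt0.
have [b b0 [r1 hgrow]] := quantile_growth mono pos le1 sv (m + 2) c20.
have [N1 hq] := exists_quantile mono pos vanish sv (Num.max r0 r1) c0.
pose N2 := archimedean.Num.bound (4 * (K + 1) / b).
have hN2 : 4 * (K + 1) / b < N2%:R.
  by apply: archimedean.Num.Theory.archi_boundP; rewrite divr_ge0 ?mulr_ge0 ?addr_ge0// ltW.
exists (maxn 4 (maxn N1 N2)) => n; rewrite !geq_max => /andP[n4 /andP[nN1 nN2]].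
have [s] := hq n nN1; rewrite ge_max => /andP[sr0 sr1] /andP[cs cs2].
have s0 : 0 < s by exact: lt_le_trans sr0.
have n0 : (0 < n)%N by exact: leq_trans n4.
have nR : (0 : R) < n%:R by rewrite ltr0n.
have n1 : (1 : R) <= n%:R by rewrite ler1n.
pose D : R := n%:R ^+ m.
have D0 : 0 < D by rewrite exprn_gt0.
have D1 : 1 <= D by rewrite exprn_ege1.
have n4R : (4 : R) <= n%:R by rewrite ler_nat.
have nD : 4 * n%:R ^+ 2 <= expR D.
  apply: (@le_trans _ _ D); last by apply: le_trans (expR_ge1Dx D); rewrite lerDr.
  apply: (@le_trans _ _ (n%:R ^+ 3)); first by rewrite [leRHS]exprS ler_wpM2r// exprn_ge0.
  by rewrite /D ler_weXn2l.
have AD : n%:R `^ A <= D by rewrite /D -powR_mulrn ?(ltW nR)// ler_powR.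
have Ds : 2 * n%:R * (2 * K + 2 * D) <= s.
  apply: le_trans (hgrow s n sr1 cs2).
  have -> : n%:R ^+ (m + 2) = D * (n%:R * n%:R) :> R by rewrite exprD expr2.
  have h1 : 4 * (K + 1) <= b * n%:R.
    rewrite [leRHS]mulrC -ler_pdivrMr//; apply: ltW; apply: lt_le_trans hN2 _.
    by rewrite ler_nat.
  have h2 : D * n%:R * (4 * (K + 1)) <= D * n%:R * (b * n%:R).
    by apply: ler_wpM2l => //; apply: mulr_ge0; apply: ltW.
  have h3 : n%:R * (K * 1) <= n%:R * (K * D) by rewrite ler_wpM2l ?(ltW nR)// ler_wpM2l.
  lra.
have [M hM] : exists M, 2 * n%:R ^+ 2 * F (2 ^+ M * s) <= eta.
  have q0 : 0 < 2 * n%:R ^+ 2 :> R by rewrite mulr_gt0// exprn_gt0.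
  have [t ht] := vanish _ (divr_gt0 eta0 q0).
  have [M hM] : exists M : nat, t / s <= 2 ^+ M.
    exists (archimedean.Num.bound `|t / s|); apply: (@le_trans _ _ `|t / s|); first exact: ler_norm.
    apply: ltW; apply: (@lt_le_trans _ _ (archimedean.Num.bound `|t / s|)%:R).
      exact: archimedean.Num.Theory.archi_boundP.
    by rewrite -natrX ler_nat ltnW// ltn_expl.
  exists M; apply: (@le_trans _ _ (2 * n%:R ^+ 2 * F t)).
    by rewrite ler_wpM2l ?(ltW q0)// mono// -ler_pdivrMr.
  by rewrite mulrC -ler_pdivlMr// ltW.
have mgood : measurable (good_event A n).
  by apply: measurable_good_event => //; case: X_iid.
rewrite -pr_setC//.
pose E1 := modulus_in X 0 (log_outside K).
pose E2 := modulus_in X n (log_outside K).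
pose E3 := \bigcap_(k < n.+1) modulus_in X k (~` [set r | s < ln r]).
pose G i j := if i != j
  then dyadic_competitor X ((minn j (n - j))%:R / (2 * n%:R)) s M i j
  else set0.
have mG i j : measurable (G i j).
  by rewrite /G; case: ifP => // _; exact: (measurable_dyadic_competitor X_iid).
pose E4 := \bigcup_(i < n.+1) \bigcup_(j in [set j | (1 <= j < n)%N]) G i j.
have mE1 : measurable E1 by apply: (measurable_modulus_in X_iid); exact: measurable_log_outside.
have mE2 : measurable E2 by apply: (measurable_modulus_in X_iid); exact: measurable_log_outside.
have mE3 : measurable E3.
  apply: bigcap_measurable => [|k _]; first by exists 0%N.
  by apply: (measurable_modulus_in X_iid); apply: measurableC; exact: measurable_log_gt.
have mrow i : measurable (\bigcup_(j in [set j | (1 <= j < n)%N]) G i j).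
  by apply: bigcup_measurable => j _; exact: mG.
have mE4 : measurable E4 by apply: bigcup_measurable => i _; exact: mrow.
have cover : pr (~` good_event A n) <= (pr E1 + pr E2) + (pr E3 + pr E4).
  apply: (@le_trans _ _ (pr (E1 `|` E2) + pr (E3 `|` E4))).
    apply: pr_cover2; [exact: measurableC|exact: measurableU|exact: measurableU|].
    move=> w /(not_good_cover M K0 D0 nD AD n0 s0 Ds)[h|h|h|]; [by left; left|by left; right|by right; left|].
    move=> [i iN [j /andP[jn ij] h]]; right; right.
    by exists i => //; exists j => //; rewrite /G ij.
  by apply: lerD; apply: pr_cover2 => //; exact: measurableU.
have b1 : pr E1 <= eta by exact: ltW.
have b2 : pr E2 <= eta by rewrite /E2 (pr_modulus_in X_iid); [exact: ltW|exact: measurable_log_outside].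
have b3 : pr E3 <= eta.
  apply: le_trans (pr_none_exceeds X_iid X_tail n.+1 s) _.
  rewrite -[leRHS]invrK lef_pV2 ?posrE ?invr_gt0//; last by rewrite ltr_pwDl// mulr_ge0// ltW.
  apply: le_trans cs _; rewrite -natr1 mulrDl mul1r; have := pos s; lra.
have b4 : pr E4 <= eta + eta.
  have h := @sum_pr_dyadic_competitor _ _ _ _ X X_iid X_tail eps s n M n0 s0 (ltW eps0)
    (fun r sr => hkar r n (le_trans sr0 sr) n0).
  apply: (@le_trans _ _ (2 * n%:R ^+ 2 * F (2 ^+ M * s) + 4 * eps * (n%:R * F s) ^+ 2)).
    apply: le_trans h.
    apply: (@le_trans _ _ (\sum_(0 <= i < n.+1)
        pr (\bigcup_(j in [set j | (1 <= j < n)%N]) G i j))).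
      by apply: pr_cover => // w [i iN h]; exists i.
    apply: ler_sum => i _; rewrite big_mkcond/=.
    apply: (@le_trans _ _ (\sum_(0 <= j < n) pr (if (0 < j)%N then G i j else set0))).
      apply: pr_cover => [//|j _|w [j /= /andP[j1 jn] h]]; first by case: ifP.
      by exists j => //; rewrite j1.
    have pr0 : pr set0 = 0 by rewrite /pr measure0.
    rewrite [leLHS]big_ltn//= pr0 add0r big_nat_cond [leRHS]big_nat_cond.
    apply: ler_sum => j /andP[/andP[j1 _] _]; rewrite j1 /G.
    by case: ifP; rewrite ?pr0.
  apply: lerD => //.
  have c2 : 0 < c ^+ 2 by rewrite exprn_gt0.
  have h2 : (n%:R * F s) ^+ 2 <= (2 * c) ^+ 2.
    by rewrite lerXn2r ?nnegrE ?(ltW c20)// mulr_ge0 ?(ltW (pos s)).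
  apply: (@le_trans _ _ (4 * eps * (2 * c) ^+ 2)).
    by rewrite ler_wpM2l// mulr_ge0// ltW.
  have e1 : eps * (16 * c ^+ 2) = eta by rewrite /eps divfK// gt_eqF// mulr_gt0.
  rewrite exprMn; lra.
lra.
Qed.

End Assembly.

Unset Implicit Arguments.

Theorem theorem1p5 (d : measure_display) (T : measurableType d) (R : realType)
    (P : probability T R) (xi : nat -> T -> R[i])
    (xi_iid : complex_iid P xi)
    (xi_nondegenerate : nondegenerate_rv P (xi 0%N))
    (xi_neq0 : {ae P, forall w, xi 0%N w != 0})
    (xi_tail : slowly_varying (log_tail P (xi 0%N)))
    (tau : nat -> T -> nat)
    (tau_max : forall n w, is_max_index (fun k => xi k w) n (tau n w))
    (A : R) (A_gt0 : 0 < A) :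
  let good (n : nat) : set T :=
    [set w | [/\ unique_max (fun k => xi k w) n (tau n w),
                 roots_close A (fun k => xi k w) n (tau n w) &
                 roots_separated A (fun k => xi k w) n (tau n w)]] in
  (forall n, measurable (good n)) /\ P (good n) @[n --> \oo] --> 1%E.
Proof.
move=> good'; have mgood n : measurable (good' n).
  by apply: measurable_good_event => //; case: xi_iid.
split=> //.
under eq_fun do rewrite prE//.
apply: cvg_EFin; first by near=> n.
apply/cvgrPdist_le => eta eta0.
have [N hN] := pr_good_event_ge xi_iid xi_neq0 xi_tail tau_max A (divr_gt0 eta0 (ltr0n R 5)).
exists N => // n /= nN; rewrite ger0_norm; last by rewrite subr_ge0 pr_le1.
by have := hN n nN; rewrite mulrC divfK.
Unshelve. all: by end_near.
Qed.
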